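(* INF proves that the Rosser counting axiom, $\forall x\in\mathbb{F}\,(\{z\in\mathbb{F}:z<x\}\in x)$, implies the Church counting axiom, $\forall j\in\mathbb{N}\,(j\,\mathsf{S}\,\mathbf{0}=j)$.
   Context: INF (intuitionistic New Foundations) is the first-order theory with equality over intuitionistic logic, with one binary predicate $\in$, whose axioms are extensionality ($\forall z(z\in x\leftrightarrow z\in y)\to x=y$) and stratified comprehension (the set $\{x:\varphi\}$ exists for every stratified $\varphi$, parameters allowed; $\varphi$ is stratified if its variables can be assigned natural-number indices so that in each subformula $x\in y$ the index of $y$ is one more than that of $x$, and in each $x=y$ the indices agree). Ordered pairs are $\langle x,y\rangle=\{\{x\},\{x,y\}\}$. $\mathrm{FUNC}=\{f:\forall x,y,z(\langle x,y\rangle\in f\to\langle x,z\rangle\in f\to y=z)\}$. Application: $Ap(f,x)=\{t:\exists y(\langle x,y\rangle\in f\land t\in y)\}$, so $Ap(f,x)=y$ if $f\in\mathrm{FUNC}$ and $\langle x,y\rangle\in f$. Write $fx$ for $Ap(f,x)$, associating to the left; so $j\,\mathsf{S}\,\mathbf{0}$ means $Ap(Ap(j,\mathsf{S}),\mathbf{0})$. Church numbers: $\mathbf{0}=\{\langle f,\mathrm{id}\rangle: f=f\}$ with $\mathrm{id}=\{\langle x,x\rangle:x=x\}$. Church successor is the set of all pairs $\langle z,s_z\rangle$ with $z\in\mathrm{FUNC}$, where $s_z$ is the set of all $\langle f,p\rangle$ with $f\in\mathrm{FUNC}$ and $\forall u\,(u\in p\leftrightarrow\exists x,w,t,q\,(u=\langle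 x,w\rangle\land t\in\mathrm{FUNC}\land\langle f,t\rangle\in z\land\langle x,q\rangle\in t\land\langle q,w\rangle\in f))$; it is denoted $\mathsf{S}$. $\mathbb{N}$ is the intersection of all sets containing $\mathbf{0}$ and closed under $\mathsf{S}$. Frege cardinals: $\mathsf{zero}=\{\emptyset\}$; the Frege successor of $x$ is $x^+=\{u\cup\{c\}: u\in x,\ c\notin u\}$; $\mathbb{F}$ (the finite Frege cardinals) is the intersection of all sets $w$ with $\mathsf{zero}\in w$ and $\forall x\,(x\in w\land\exists u(u\in x^+)\to x^+\in w)$. Order on $\mathbb{F}$: $x\le y$ means there are $a\in x$, $b\in y$ with $a\subseteq b$ and $b=a\cup(b-a)$ ($a$ is a separable subset of $b$); $x<y$ means $x\le y$ and $x\ne y$. *)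

(* Defs.v *)
From Stdlib Require Import List.

(** * First-order formulas over [∈] and [=]

    Variables are de Bruijn indices. There are no other terms, so substitution
    is renaming. *)

Inductive form : Type :=
| Mem (x y : nat)
| Eq (x y : nat)
| Bot
| And (A B : form)
| Or (A B : form)
| Imp (A B : form)
| All (A : form)
| Ex (A : form).

Definition Iff (A B : form) : form := And (Imp A B) (Imp B A).

Definition up (r : nat -> nat) (n : nat) : nat :=
  match n with 0 => 0 | S k => S (r k) end.

Fixpoint ren (r : nat -> nat) (A : form) : form :=
  match A with
  | Mem x y => Mem (r x) (r y)
  | Eq x y => Eq (r x) (r y)
  | Bot => Bot
  | And A B => And (ren r A) (ren r B)
  | Or A B => Or (ren r A) (ren r B)
  | Imp A B => Imp (ren r A) (ren r B)
  | All A => All (ren (up r) A)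
  | Ex A => Ex (ren (up r) A)
  end.

Definition shift : form -> form := ren S.

(** [inst x A] is [A[x/0]], the other free variables being lowered by one. *)
Definition inst (x : nat) : form -> form :=
  ren (fun n => match n with 0 => x | S k => k end).

(** * Intuitionistic natural deduction with equality

    Axioms from [T] may be used under any eigenvariable, so an open axiom counts
    as its universal closure. The hypotheses [G], on the other hand, are fixed. *)

Inductive nd (T : form -> Prop) : list form -> form -> Prop :=
| nd_ax G A : T A -> nd T G A
| nd_hyp G A : In A G -> nd T G A
| nd_botE G A : nd T G Bot -> nd T G A
| nd_andI G A B : nd T G A -> nd T G B -> nd T G (And A B)
| nd_andE1 G A B : nd T G (And A B) -> nd T G A
| nd_andE2 G A B : nd T G (And A B) -> nd T G B
| nd_orI1 G A B : nd T G A -> nd T G (Or A B)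
| nd_orI2 G A B : nd T G B -> nd T G (Or A B)
| nd_orE G A B C :
    nd T G (Or A B) -> nd T (A :: G) C -> nd T (B :: G) C -> nd T G C
| nd_impI G A B : nd T (A :: G) B -> nd T G (Imp A B)
| nd_impE G A B : nd T G (Imp A B) -> nd T G A -> nd T G B
| nd_allI G A : nd T (map shift G) A -> nd T G (All A)
| nd_allE G A x : nd T G (All A) -> nd T G (inst x A)
| nd_exI G A x : nd T G (inst x A) -> nd T G (Ex A)
| nd_exE G A C :
    nd T G (Ex A) -> nd T (A :: map shift G) (shift C) -> nd T G C
| nd_eq_refl G x : nd T G (Eq x x)
| nd_eq_subst G A x y :
    nd T G (Eq x y) -> nd T G (inst x A) -> nd T G (inst y A).

(** * Stratification

    [s] gives the types of the free variables; each bound variable receives its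
    own type at its binder. *)

Fixpoint strat (s : nat -> nat) (A : form) : Prop :=
  match A with
  | Mem x y => s y = S (s x)
  | Eq x y => s x = s y
  | Bot => True
  | And A B | Or A B | Imp A B => strat s A /\ strat s B
  | All A | Ex A =>
      exists k, strat (fun n => match n with 0 => k | S m => s m end) A
  end.

Definition stratified (A : form) : Prop := exists s, strat s A.

(** * Named syntax

    An [fm] is a formula awaiting its binding depth. Variables of an [fm] are de
    Bruijn levels: at depth [n], level [l] is the index [n - S l]. This lets
    formulas be written with Rocq binders; closed formulas are read at depth 0. *)

Definition fm : Type := nat -> form.

(** [Cls P] is the class abstract [{x : P x}]. It is not part of the object
    language: atomic formulas mentioning it are eliminated by [memT] and [eqT]. *)
Inductive term : Type :=
| Var (l : nat)
| Cls (P : nat -> fm).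

Definition fmBot : fm := fun _ => Bot.
Definition fmAnd (A B : fm) : fm := fun n => And (A n) (B n).
Definition fmOr (A B : fm) : fm := fun n => Or (A n) (B n).
Definition fmImp (A B : fm) : fm := fun n => Imp (A n) (B n).
Definition fmIff (A B : fm) : fm := fun n => Iff (A n) (B n).
Definition fmNot (A : fm) : fm := fmImp A fmBot.
Definition fmAll (P : term -> fm) : fm := fun n => All (P (Var n) (S n)).
Definition fmEx (P : term -> fm) : fm := fun n => Ex (P (Var n) (S n)).
Definition cls (P : term -> fm) : term := Cls (fun l => P (Var l)).

Definition memV (x : nat) (b : term) : fm :=
  match b with
  | Var y => fun n => Mem (n - S x) (n - S y)
  | Cls P => P x
  end.

(** Equality with a class abstract means having the same elements. *)
Definition eqT (a b : term) : fm :=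
  match a, b with
  | Var x, Var y => fun n => Eq (n - S x) (n - S y)
  | _, _ => fun n => All (Iff (memV n a (S n)) (memV n b (S n)))
  end.

(** [{x : P x} ∈ b] means [∃ z, z = {x : P x} ∧ z ∈ b]. *)
Definition memT (a b : term) : fm :=
  match a with
  | Var x => memV x b
  | Cls _ => fun n => Ex (And (eqT (Var n) a (S n)) (memV n b (S n)))
  end.

Declare Scope fm_scope.
Delimit Scope fm_scope with fm.
Bind Scope fm_scope with fm.
Bind Scope fm_scope with term.

Notation "a ∈ b" := (memT a b) (at level 70, no associativity) : fm_scope.
Notation "a ∉ b" := (fmNot (memT a b)) (at level 70, no associativity) : fm_scope.
Notation "a = b" := (eqT a b) : fm_scope.
Notation "a ≠ b" := (fmNot (eqT a b)) (at level 70, no associativity) : fm_scope.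
Notation "A ∧ B" := (fmAnd A B) (at level 80, right associativity) : fm_scope.
Notation "A ∨ B" := (fmOr A B) (at level 85, right associativity) : fm_scope.
Notation "A ⇔ B" := (fmIff A B) (at level 95, no associativity) : fm_scope.
Notation "A ⇒ B" := (fmImp A B) (at level 99, right associativity) : fm_scope.
Notation "∀ x .. y , A" := (fmAll (fun x => .. (fmAll (fun y => A)) ..))
  (at level 200, x binder, y binder, right associativity) : fm_scope.
Notation "∃ x .. y , A" := (fmEx (fun x => .. (fmEx (fun y => A)) ..))
  (at level 200, x binder, y binder, right associativity) : fm_scope.
Notation "⦃ x | A ⦄" := (cls (fun x => A))
  (at level 0, x name, A at level 200) : fm_scope.

Local Open Scope fm_scope.

(** * The theory INF *)

Definition extensionality : form :=
  (∀ x y, (∀ z, z ∈ x ⇔ z ∈ y) ⇒ x = y) 0.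

(** In [A], index 0 is the comprehension variable and all others are parameters:
    this is [∃ y, ∀ x, x ∈ y ↔ A], with [y] not free in [A]. *)
Definition comprehension (A : form) : form :=
  Ex (All (Iff (Mem 0 1) (ren (up S) A))).

Inductive INF : form -> Prop :=
| INF_ext : INF extensionality
| INF_compr A : stratified A -> INF (comprehension A).

Definition INF_proves (A : fm) : Prop := nd INF nil (A 0).

(** * Pairs, functions and Church numbers *)

Definition sing (x : term) : term := ⦃ t | t = x ⦄.
Definition upair (x y : term) : term := ⦃ t | t = x ∨ t = y ⦄.
Definition pair (x y : term) : term := upair (sing x) (upair x y).

Notation "⟨ x , y ⟩" := (pair x y) (at level 0, x at level 99, y at level 99) : fm_scope.

Definition FUNC : term :=
  ⦃ f | ∀ x y z, ⟨x, y⟩ ∈ f ⇒ ⟨x, z⟩ ∈ f ⇒ y = z ⦄.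

Definition Ap (f x : term) : term := ⦃ t | ∃ y, ⟨x, y⟩ ∈ f ∧ t ∈ y ⦄.

Definition idT : term := ⦃ u | ∃ x, x = x ∧ u = ⟨x, x⟩ ⦄.

Definition church0 : term := ⦃ u | ∃ f, f = f ∧ u = ⟨f, idT⟩ ⦄.

Definition church_succ_at (z : term) : term :=
  ⦃ v | ∃ f p, v = ⟨f, p⟩ ∧ f ∈ FUNC ∧
          (∀ u, u ∈ p ⇔ (∃ x w t q,
             u = ⟨x, w⟩ ∧ t ∈ FUNC ∧ ⟨f, t⟩ ∈ z ∧ ⟨x, q⟩ ∈ t ∧ ⟨q, w⟩ ∈ f)) ⦄.

Definition churchS : term :=
  ⦃ v | ∃ z, z ∈ FUNC ∧ v = ⟨z, church_succ_at z⟩ ⦄.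

Definition churchN : term :=
  ⦃ n | ∀ w, church0 ∈ w ∧ (∀ x, x ∈ w ⇒ Ap churchS x ∈ w) ⇒ n ∈ w ⦄.

(** * Finite Frege cardinals *)

Definition empty : term := ⦃ x | fmBot ⦄.
Definition zero : term := sing empty.
Definition union (a b : term) : term := ⦃ t | t ∈ a ∨ t ∈ b ⦄.
Definition diff (a b : term) : term := ⦃ t | t ∈ a ∧ t ∉ b ⦄.
Definition subset (a b : term) : fm := ∀ t, t ∈ a ⇒ t ∈ b.

Definition frege_succ (x : term) : term :=
  ⦃ v | ∃ u c, u ∈ x ∧ c ∉ u ∧ v = union u (sing c) ⦄.

Definition fregeF : term :=
  ⦃ n | ∀ w, zero ∈ w ∧
          (∀ x, x ∈ w ∧ (∃ u, u ∈ frege_succ x) ⇒ frege_succ x ∈ w) ⇒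
          n ∈ w ⦄.

Definition card_le (x y : term) : fm :=
  ∃ a b, a ∈ x ∧ b ∈ y ∧ subset a b ∧ b = union a (diff b a).

Definition card_lt (x y : term) : fm := card_le x y ∧ x ≠ y.

(** * The counting axioms *)

Definition rosser_counting : fm :=
  ∀ x, x ∈ fregeF ⇒ ⦃ z | z ∈ fregeF ∧ card_lt z x ⦄ ∈ x.

Definition church_counting : fm :=
  ∀ j, j ∈ churchN ⇒ Ap (Ap j churchS) church0 = j.

(* Main.v *)
From Stdlib Require Import List Lia Arith Cantor.
Require Import Defs.
Import ListNotations.

(** Derivability in INF is forcing in a Kripke-Beth model whose worlds are the
    finite contexts and whose individuals are the variables ([force_iff]), so
    the argument is carried out on truth values, with comprehension for
    stratified predicates only.

    By Rosser's axiom [{z : z < x} ∪ {x}] lies in [x^+], so every finite cardinal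
    has an inhabited successor. Let [numR] relate the [n]-th Frege number to the
    [n]-th Church number. The term [j S 0] has its type six below that of [j], while
    [theta x y], i.e. [{z : z < y} ∈ x], is a stratified relation between [x] and a
    [y] two types lower, preserved by successors. Induction on [j] therefore gives
    [theta x y1], [theta y1 y2] and [theta y2 y3] where [numR] relates [x] to [j]
    and [y3] to [j S 0]. Rosser's axiom also says [theta y y], which forces
    [x = y1 = y2 = y3], and then [j = j S 0] because [numR] is functional. *)

(** * Renaming, type assignments and the structural rules of derivability *)

Definition scons {X} (x : X) (f : nat -> X) (n : nat) : X :=
  match n with 0 => x | S k => f k end.

Lemma ren_ext r r' A : (forall n, r n = r' n) -> ren r A = ren r' A.
Proof.
  revert r r'; induction A; intros r r' H; simpl; f_equal; auto;
    apply IHA; intros [|n]; simpl; auto.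
Qed.

Lemma ren_ren r q A : ren r (ren q A) = ren (fun n => r (q n)) A.
Proof.
  revert r q; induction A; intros r q; simpl; f_equal; auto;
    rewrite IHA; apply ren_ext; intros [|n]; reflexivity.
Qed.

Lemma ren_id r A : (forall n, r n = n) -> ren r A = A.
Proof.
  revert r; induction A; intros r H; simpl; f_equal; auto;
    apply IHA; intros [|n]; simpl; auto.
Qed.

Lemma ren_fv A :
  exists n, forall r r', (forall k, k < n -> r k = r' k) -> ren r A = ren r' A.
Proof.
  induction A.
  1,2: exists (S (x + y)); intros r r' H; simpl; f_equal; apply H; lia.
  1: now exists 0.
  1-3: destruct IHA1 as [n1 H1], IHA2 as [n2 H2]; exists (n1 + n2);
    intros r r' H; simpl; f_equal; [apply H1|apply H2]; intros; apply H; lia.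
  1,2: destruct IHA as [n H1]; exists n; intros r r' H; simpl; f_equal;
    apply H1; intros [|k] Hk; simpl; auto; f_equal; apply H; lia.
Qed.

Lemma ren_list_fv G :
  exists n, forall r r', (forall k, k < n -> r k = r' k) -> map (ren r) G = map (ren r') G.
Proof.
  induction G as [|A G [n2 H2]]; [now exists 0|].
  destruct (ren_fv A) as [n1 H1]; exists (n1 + n2).
  intros r r' H; simpl; f_equal; [apply H1|apply H2]; intros; apply H; lia.
Qed.

Lemma strat_ext s s' A : (forall n, s n = s' n) -> strat s A -> strat s' A.
Proof.
  revert s s'; induction A; intros s s' H; simpl; rewrite <- ?H; auto;
    try (intros [H1 H2]; split; eauto; fail);
    intros [k Hk]; exists k; revert Hk; apply IHA; intros [|n]; auto.
Qed.

Lemma strat_ren s r A : strat (fun n => s (r n)) A -> strat s (ren r A).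
Proof.
  revert s r; induction A; intros s r; simpl; auto;
    try (intros [H1 H2]; split; auto; fail);
    intros [k Hk]; exists k; apply IHA; revert Hk; apply strat_ext; intros [|n]; auto.
Qed.

(** Only left-invertible renamings preserve derivability outright: identifying
    parameters of a comprehension axiom can destroy its stratification. *)
Lemma nd_ren G A r q :
  (forall n, q (r n) = n) -> nd INF G A -> nd INF (map (ren r) G) (ren r A).
Proof.
  intros Hq H; revert r q Hq.
  assert (Hup : forall r q, (forall n, q (r n) = n) -> forall n, up q (up r n) = n).
  { intros r q Hq [|n]; simpl; auto. }
  assert (Hsh : forall r G, map shift (map (ren r) G) = map (ren (up r)) (map shift G)).
  { intros r G'; rewrite !map_map; apply map_ext; intros B; unfold shift.
    rewrite !ren_ren; reflexivity. }
  assert (Hinst : forall r x B, ren r (inst x B) = inst (r x) (ren (up r) B)).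
  { intros r x B; unfold inst; rewrite !ren_ren; apply ren_ext; intros [|n]; reflexivity. }
  induction H; intros r q Hq; simpl.
  - apply nd_ax. destruct H as [|A [s Hs]].
    + constructor.
    + unfold comprehension; simpl.
      replace (ren (up (up r)) (ren (up S) A)) with (ren (up S) (ren (up r) A))
        by (rewrite !ren_ren; apply ren_ext; intros [|n]; reflexivity).
      (* The left inverse transports the types: index [n] of the renamed formula receives the type
         that [up q n] had in [A]. *)
      apply (INF_compr (ren (up r) A)); exists (fun n => s (up q n)).
      apply strat_ren; revert Hs; apply strat_ext; intros n; now rewrite Hup.
  - apply nd_hyp; now apply in_map.
  - apply nd_botE; eapply IHnd; eauto.
  - apply nd_andI; [eapply IHnd1|eapply IHnd2]; eauto.
  - eapply nd_andE1; eapply IHnd; eauto.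
  - eapply nd_andE2; eapply IHnd; eauto.
  - apply nd_orI1; eapply IHnd; eauto.
  - apply nd_orI2; eapply IHnd; eauto.
  - eapply nd_orE; [eapply IHnd1|eapply IHnd2|eapply IHnd3]; eauto.
  - apply nd_impI; eapply IHnd; eauto.
  - eapply nd_impE; [eapply IHnd1|eapply IHnd2]; eauto.
  - apply nd_allI; rewrite Hsh; eapply IHnd; eauto.
  - rewrite Hinst; apply nd_allE; apply (IHnd r q Hq).
  - apply nd_exI with (x := r x); rewrite <- Hinst; eapply IHnd; eauto.
  - eapply nd_exE; [apply (IHnd1 r q Hq)|]. rewrite Hsh.
    replace (shift (ren r C)) with (ren (up r) (shift C))
      by (unfold shift; now rewrite !ren_ren).
    eapply (IHnd2 (up r) (up q)); auto.
  - apply nd_eq_refl.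
  - rewrite Hinst; eapply nd_eq_subst; [eapply (IHnd1 r q)|]; auto.
    rewrite <- Hinst; eapply IHnd2; eauto.
Qed.

Lemma nd_weak G G' A : incl G G' -> nd INF G A -> nd INF G' A.
Proof.
  intros Hi H; revert G' Hi; induction H; intros G' Hi.
  - now apply nd_ax.
  - apply nd_hyp; auto.
  - apply nd_botE; auto.
  - apply nd_andI; auto.
  - eapply nd_andE1; eauto.
  - eapply nd_andE2; eauto.
  - apply nd_orI1; auto.
  - apply nd_orI2; auto.
  - eapply nd_orE; [eauto|apply IHnd2|apply IHnd3];
      apply incl_cons; simpl; auto using incl_tl.
  - apply nd_impI, IHnd, incl_cons; simpl; auto using incl_tl.
  - eapply nd_impE; eauto.
  - apply nd_allI, IHnd, incl_map, Hi.
  - apply nd_allE; auto.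
  - eapply nd_exI; eauto.
  - eapply nd_exE; [eauto|]. apply IHnd2, incl_cons; simpl; auto.
    apply incl_tl, incl_map, Hi.
  - apply nd_eq_refl.
  - eapply nd_eq_subst; eauto.
Qed.

(** Some variable [x] occurs neither in [G] nor in [A]. The renaming [r] sends it to the
    eigenvariable 0 and every other index to its successor, so it acts on [G] as [shift], turns
    [inst x A] back into [A], and has the left inverse [q]. *)
Lemma nd_all_fresh G A : (forall x, nd INF G (inst x A)) -> nd INF G (All A).
Proof.
  intros H. destruct (ren_list_fv G) as [n1 H1], (ren_fv A) as [n2 H2].
  set (x := n1 + n2).
  set (r := fun n => if n =? x then 0 else S n).
  set (q := fun n => match n with 0 => x | S k => k end).
  assert (Hq : forall n, q (r n) = n).
  { intros n; unfold q, r; destruct (Nat.eqb_spec n x); auto. }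
  apply nd_allI. generalize (nd_ren _ _ r q Hq (H x)).
  replace (map (ren r) G) with (map shift G).
  - replace (ren r (inst x A)) with A; auto.
    unfold inst; rewrite ren_ren. rewrite <- (ren_id (fun n => n) A) at 1 by auto.
    apply H2; intros [|k] Hk; unfold r.
    + now rewrite Nat.eqb_refl.
    + destruct (Nat.eqb_spec k x); lia.
  - apply H1; intros k Hk; unfold r. destruct (Nat.eqb_spec k x); lia.
Qed.

(** A formula derivable in every context may be generalised by [nd_allI] and instantiated by
    [nd_allE] one variable at a time. This covers renamings that identify variables, which [nd_ren]
    excludes. *)
Lemma nd_valid_ren A : (forall G, nd INF G A) -> forall G r, nd INF G (ren r A).
Proof.
  intros H.
  assert (K : forall n r G, nd INF G (ren (fun k => if k <? n then r k else k - n) A)).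
  { induction n; intros r G.
    - rewrite ren_id; auto. intros k; simpl; lia.
    - generalize (nd_allE INF G _ (r n) (nd_allI INF G _ (IHn (fun k => S (r k)) _))).
      unfold inst; rewrite ren_ren. intros K; erewrite ren_ext; [exact K|].
      intros k; simpl.
      destruct (Nat.ltb_spec k n), (Nat.ltb_spec k (S n)); try lia; auto.
      + replace k with n by lia. now rewrite Nat.sub_diag.
      + now replace (k - n) with (S (k - S n)) by lia. }
  intros G r. destruct (ren_fv A) as [n Hn].
  rewrite (Hn r (fun k => if k <? n then r k else k - n)); auto.
  intros k Hk; now apply Nat.ltb_lt in Hk; rewrite Hk.
Qed.

(** * Truth values: regular upward closed sets of contexts *)

Definition world := list form.
Definition V := nat.

Record prop := mkprop {
  at_ : world -> Prop;
  mono : forall G G', incl G G' -> at_ G -> at_ G';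
  (* [at_] is closed under the elimination rules for [Or] and [Ex]. *)
  reg : forall G,
    (forall G' C, incl G G' -> (forall G2, incl G' G2 -> at_ G2 -> nd INF G2 C) -> nd INF G' C) ->
    at_ G
}.

Declare Scope k_scope.
Delimit Scope k_scope with k.
Bind Scope k_scope with prop.
Notation "G ⊩ P" := (at_ P%k G) (at level 100, P at level 200, no associativity).

Program Definition kAtom (A : form) : prop := mkprop (fun G => nd INF G A) _ _.
Next Obligation. eapply nd_weak; eauto. Qed.
Next Obligation. apply H; [apply incl_refl|auto]. Qed.

Definition kMem (x y : V) : prop := kAtom (Mem x y).
Definition kEq (x y : V) : prop := kAtom (Eq x y).
Definition kBot : prop := kAtom Bot.

Program Definition kAnd (P Q : prop) : prop := mkprop (fun G => (G ⊩ P) /\ (G ⊩ Q)) _ _.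
Next Obligation. split; eapply mono; eauto. Qed.
Next Obligation.
  split; apply reg; intros G' C Hi HC; apply H; auto; intros G2 H2 []; auto.
Qed.

Program Definition kImp (P Q : prop) : prop :=
  mkprop (fun G => forall G', incl G G' -> (G' ⊩ P) -> (G' ⊩ Q)) _ _.
Next Obligation. apply H0; auto. eapply incl_tran; eauto. Qed.
Next Obligation.
  apply reg; intros G2 C Hi HC. apply H; [eapply incl_tran; eauto|].
  intros G3 H3 K. apply HC; auto. apply K; [apply incl_refl|].
  eapply mono; [|eauto]. eapply incl_tran; eauto.
Qed.

Program Definition kAll (P : V -> prop) : prop := mkprop (fun G => forall x, G ⊩ P x) _ _.
Next Obligation. eapply mono; eauto. Qed.
Next Obligation. apply reg; intros G' C Hi HC; apply H; auto. Qed.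

(** [kOr] and [kEx] are impredicative, as a context may prove a disjunction
    without proving either side. *)
Program Definition kOr (P Q : prop) : prop :=
  mkprop (fun G => forall G' C, incl G G' ->
    (forall G2, incl G' G2 -> (G2 ⊩ P) -> nd INF G2 C) ->
    (forall G2, incl G' G2 -> (G2 ⊩ Q) -> nd INF G2 C) -> nd INF G' C) _ _.
Next Obligation. apply H0; auto. eapply incl_tran; eauto. Qed.
Next Obligation.
  apply H; auto. intros G2 Hi K; apply K; [apply incl_refl|..];
    intros; [apply H1|apply H2]; auto; eapply incl_tran; eauto.
Qed.

Program Definition kEx (P : V -> prop) : prop :=
  mkprop (fun G => forall G' C, incl G G' ->
    (forall G2 x, incl G' G2 -> (G2 ⊩ P x) -> nd INF G2 C) -> nd INF G' C) _ _.
Next Obligation. apply H0; auto. eapply incl_tran; eauto. Qed.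
Next Obligation.
  apply H; auto. intros G2 Hi K; apply K; [apply incl_refl|].
  intros G3 x H3; apply H1; eapply incl_tran; eauto.
Qed.

Definition kIff (P Q : prop) : prop := kAnd (kImp P Q) (kImp Q P).
Definition kNot (P : prop) : prop := kImp P kBot.

Notation "x ∈ y" := (kMem x y) (at level 70, no associativity) : k_scope.
Notation "x ∉ y" := (kNot (kMem x y)) (at level 70, no associativity) : k_scope.
Notation "x = y" := (kEq x y) : k_scope.
Notation "x ≠ y" := (kNot (kEq x y)) (at level 70, no associativity) : k_scope.
Notation "A ∧ B" := (kAnd A B) (at level 80, right associativity) : k_scope.
Notation "A ∨ B" := (kOr A B) (at level 85, right associativity) : k_scope.
Notation "A ⇔ B" := (kIff A B) (at level 95, no associativity) : k_scope.
Notation "A ⇒ B" := (kImp A B) (at level 99, right associativity) : k_scope.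
Notation "∀ x .. y , A" := (kAll (fun x => .. (kAll (fun y => A%k)) ..))
  (at level 200, x binder, y binder, right associativity) : k_scope.
Notation "∃ x .. y , A" := (kEx (fun x => .. (kEx (fun y => A%k)) ..))
  (at level 200, x binder, y binder, right associativity) : k_scope.

(** * Intuitionistic rules at a world *)

Lemma inst_up e x A : inst x (ren (up e) A) = ren (scons x e) A.
Proof. unfold inst; rewrite ren_ren; apply ren_ext; intros [|]; reflexivity. Qed.

Section rules.
Context {G : world}.

Lemma botE (R : prop) : (G ⊩ kBot) -> G ⊩ R.
Proof.
  intros H; apply reg; intros G' C Hi _. apply nd_botE; exact (mono kBot _ _ Hi H).
Qed.

(** [kOr] by itself eliminates only into derivability of a formula; the field [reg] of [R] extends
    this to an arbitrary truth value. *)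
Lemma orE {P Q} (R : prop) : (G ⊩ P ∨ Q) ->
  (forall G', incl G G' -> (G' ⊩ P) -> G' ⊩ R) ->
  (forall G', incl G G' -> (G' ⊩ Q) -> G' ⊩ R) -> G ⊩ R.
Proof.
  intros H H1 H2; apply reg; intros G' C Hi HC. apply H; auto; intros G2 K KP;
    apply HC; auto; [apply H1|apply H2]; auto; eapply incl_tran; eauto.
Qed.

Lemma exE {P} (R : prop) : (G ⊩ kEx P) ->
  (forall G' x, incl G G' -> (G' ⊩ P x) -> G' ⊩ R) -> G ⊩ R.
Proof.
  intros H H1; apply reg; intros G' C Hi HC. apply H; auto; intros G2 x K KP.
  apply HC; auto; eapply H1; eauto. eapply incl_tran; eauto.
Qed.

Lemma orI1 (P Q : prop) : (G ⊩ P) -> G ⊩ P ∨ Q.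
Proof. intros H G' C Hi H1 _; apply H1; [apply incl_refl|eapply mono; eauto]. Qed.

Lemma orI2 (P Q : prop) : (G ⊩ Q) -> G ⊩ P ∨ Q.
Proof. intros H G' C Hi _ H1; apply H1; [apply incl_refl|eapply mono; eauto]. Qed.

Lemma exI x (P : V -> prop) : (G ⊩ P x) -> G ⊩ kEx P.
Proof. intros H G' C Hi H1; apply (H1 G' x); [apply incl_refl|eapply mono; eauto]. Qed.

Lemma impE {P Q} : (G ⊩ P ⇒ Q) -> (G ⊩ P) -> (G ⊩ Q).
Proof. intros H; apply H, incl_refl. Qed.

Lemma iffE {P Q} : (G ⊩ P ⇔ Q) -> (G ⊩ P) <-> (G ⊩ Q).
Proof. intros [H1 H2]; split; now apply impE. Qed.

Lemma keq_refl x : G ⊩ x = x.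
Proof. apply nd_eq_refl. Qed.

Lemma nd_leib A (e : nat -> V) x y : (G ⊩ x = y) ->
  nd INF G (ren (scons x e) A) -> nd INF G (ren (scons y e) A).
Proof.
  intros H. generalize (nd_eq_subst INF G (ren (up e) A) x y H). now rewrite !inst_up.
Qed.
End rules.

(** * Forcing and its agreement with derivability *)

Fixpoint force (e : nat -> V) (A : form) : prop :=
  match A with
  | Mem x y => kMem (e x) (e y)
  | Eq x y => kEq (e x) (e y)
  | Bot => kBot
  | And A B => kAnd (force e A) (force e B)
  | Or A B => kOr (force e A) (force e B)
  | Imp A B => kImp (force e A) (force e B)
  | All A => kAll (fun x => force (scons x e) A)
  | Ex A => kEx (fun x => force (scons x e) A)
  end.

(** A quantifier ranges semantically over all variables, of which only finitely many occur in the
    context, so a fresh one serves as eigenvariable. *)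
Theorem force_iff e A G : (G ⊩ force e A) <-> nd INF G (ren e A).
Proof.
  revert e G; induction A; intros e G; simpl; try reflexivity.
  - rewrite IHA1, IHA2; split.
    + intros []; now apply nd_andI.
    + intros H; split; [eapply nd_andE1|eapply nd_andE2]; eauto.
  - split.
    + intros H; apply H; [apply incl_refl|..]; intros G2 Hi K;
        [apply nd_orI1, IHA1|apply nd_orI2, IHA2]; auto.
    + intros H G' C Hi H1 H2. eapply nd_orE; [eapply nd_weak; eauto|..].
      * apply H1; [now apply incl_tl, incl_refl|]. apply IHA1, nd_hyp; now left.
      * apply H2; [now apply incl_tl, incl_refl|]. apply IHA2, nd_hyp; now left.
  - split.
    + intros H; apply nd_impI, IHA2, H; [now apply incl_tl, incl_refl|].
      apply IHA1, nd_hyp; now left.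
    + intros H G' Hi K; apply IHA2. eapply nd_impE; [eapply nd_weak; eauto|].
      now apply IHA1.
  - split.
    + intros H; apply nd_all_fresh; intros x; rewrite inst_up; now apply IHA.
    + intros H x; apply IHA; rewrite <- inst_up; now apply nd_allE.
  - split.
    + intros H; apply H; [apply incl_refl|]. intros G2 x Hi K.
      apply nd_exI with (x := x); rewrite inst_up; now apply IHA.
    + intros H G' C Hi H1.
      set (A' := ren (up e) A) in *.
      (* The semantic hypothesis speaks of each [x] separately. Collecting it into one universal
         implication allows its instantiation at the eigenvariable of [nd_exE]. *)
      assert (K : nd INF G' (All (Imp A' (shift C)))).
      { apply nd_all_fresh; intros x. unfold inst; simpl; unfold shift; rewrite ren_ren.
        apply nd_impI. rewrite (ren_id (fun n => n)) by auto.
        apply (H1 _ x); [now apply incl_tl, incl_refl|].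
        apply IHA, nd_hyp; left. unfold A'. rewrite <- inst_up. reflexivity. }
      eapply nd_exE; [eapply nd_weak; eauto|].
      apply nd_impE with (A := A'); [|apply nd_hyp; now left].
      apply nd_weak with (G := map shift G'); [now apply incl_tl, incl_refl|].
      generalize (nd_ren _ _ S pred (fun n => Nat.pred_succ n) K).
      fold shift; intros K2. apply (nd_allE _ _ _ 0) in K2. revert K2.
      unfold inst; simpl; fold shift. rewrite !ren_ren; unfold shift at 2; rewrite ren_ren.
      rewrite (ren_id _ A') by (intros [|]; reflexivity).
      now rewrite (ren_ext _ S) by (intros [|]; reflexivity).
Qed.

(** * Stratification of predicates on truth values

    A parameter may be used at several types: the deep formula behind a predicate
    contains one variable for each parameter and type, coded by a Cantor pair. *)

Definition env (e : list V) : nat -> V := fold_right scons (fun k => fst (of_nat k)) e.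
Definition tenv (t : list nat) : nat -> nat := fold_right scons (fun k => snd (of_nat k)) t.

(** The list [e] holds the values of the variables bound so far, innermost first, and [t] their
    types. [svar] says that a single variable of type [a] in the deep formula always denotes
    [i e]. *)
Definition svar (t : list nat) (i : list V -> V) (a : nat) : Prop :=
  exists k, tenv t k = a /\ forall e, length e = length t -> env e k = i e.

Definition spred (t : list nat) (P : list V -> prop) : Prop :=
  exists A, strat (tenv t) A /\
    forall e, length e = length t -> forall G, (G ⊩ P e) <-> (G ⊩ force (env e) A).

Definition head (e : list V) : V := hd 0 e.

Lemma env_const {X} (f : nat -> X) (l : list X) k : fold_right scons f l (length l + k) = f k.
Proof. induction l; simpl; auto. Qed.

(** Past the bound variables, the index coding [(c, a)] denotes [c] and has type [a], so a fixed
    parameter is available at every type. *)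
Lemma sv_const t c a : svar t (fun _ => c) a.
Proof.
  exists (length t + to_nat (c, a)); split.
  - unfold tenv; now rewrite env_const, cancel_of_to.
  - intros e <-; unfold env; now rewrite env_const, cancel_of_to.
Qed.

Lemma sv_nth k t a :
  nth_error t k = Some a -> svar t (fun e => head (Nat.iter k (@tl V) e)) a.
Proof.
  intros H; exists k; revert k H.
  induction t as [|b t IH]; intros [|k] H; simpl in H; try discriminate.
  - injection H as <-; split; auto. intros [|]; simpl; [discriminate|reflexivity].
  - destruct (IH k H) as [H1 H2]; split; auto.
    intros [|x e]; simpl; [discriminate|]; intros [= He]; rewrite H2 by auto.
    clear; unfold head. f_equal. symmetry; apply Nat.iter_swap_gen with (f := @tl V); auto.
Qed.

Lemma sp_mem t i j a : svar t i a -> svar t j (S a) -> spred t (fun e => i e ∈ j e)%k.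
Proof.
  intros [k [H1 H2]] [l [K1 K2]]; exists (Mem k l); split; [simpl; congruence|].
  intros e He G; simpl; now rewrite H2, K2.
Qed.

Lemma sp_eq t i j a : svar t i a -> svar t j a -> spred t (fun e => i e = j e)%k.
Proof.
  intros [k [H1 H2]] [l [K1 K2]]; exists (Eq k l); split; [simpl; congruence|].
  intros e He G; simpl; now rewrite H2, K2.
Qed.

Lemma sp_bot t : spred t (fun _ => kBot).
Proof. exists Bot; split; simpl; auto. reflexivity. Qed.

Lemma sp_and t P Q : spred t P -> spred t Q -> spred t (fun e => P e ∧ Q e)%k.
Proof.
  intros [A [H1 H2]] [B [K1 K2]]; exists (And A B); split; [simpl; auto|].
  intros e He G; simpl; now rewrite H2, K2.
Qed.

Lemma sp_imp t P Q : spred t P -> spred t Q -> spred t (fun e => P e ⇒ Q e)%k.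
Proof.
  intros [A [H1 H2]] [B [K1 K2]]; exists (Imp A B); split; [simpl; auto|].
  intros e He G; simpl; split; intros H G' Hi K; apply K2, H, H2; auto.
Qed.

Lemma sp_or t P Q : spred t P -> spred t Q -> spred t (fun e => P e ∨ Q e)%k.
Proof.
  intros [A [H1 H2]] [B [K1 K2]]; exists (Or A B); split; [simpl; auto|].
  intros e He G; split; intros H; eapply (orE _ H); intros G' Hi K;
    solve [apply orI1, H2; auto|apply orI2, K2; auto].
Qed.

Lemma sp_all t k (P : list V -> V -> prop) :
  spred (k :: t) (fun e => P (tl e) (head e)) -> spred t (fun e => ∀ x, P e x)%k.
Proof.
  intros [A [H1 H2]]; exists (All A); split; [now exists k|].
  intros e He G; simpl; split; intros H x.
  - apply (H2 (x :: e)); simpl; auto.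
  - apply (H2 (x :: e)); simpl; auto.
Qed.

Lemma sp_ex t k (P : list V -> V -> prop) :
  spred (k :: t) (fun e => P (tl e) (head e)) -> spred t (fun e => ∃ x, P e x)%k.
Proof.
  intros [A [H1 H2]]; exists (Ex A); split; [now exists k|].
  intros e He G; split; intros H; eapply (exE _ H); intros G' x Hi K; apply (exI x);
    apply (H2 (x :: e)); simpl; auto.
Qed.

(** Class abstracts are not individuals; [spec s P] states that the individual [s] is $\{t :
    P\,t\}$. *)
Definition spec (s : V) (P : V -> prop) : prop := ∀ t, t ∈ s ⇔ P t.

Definition stratP (P : V -> prop) : Prop := exists a, spred [a] (fun e => P (head e)).

Lemma sp_spec t k s P :
  svar t s (S k) -> spred (k :: t) (fun e => P (tl e) (head e)) ->
  spred t (fun e => spec (s e) (P e)).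
Proof.
  intros [l [H1 H2]] HP. apply (sp_all t k). unfold kIff.
  assert (Hm : spred (k :: t) (fun e => head e ∈ s (tl e))%k).
  { apply sp_mem with k; [now apply (sv_nth 0)|]. exists (S l); split; auto.
    intros [|x e]; simpl; [discriminate|]; intros [= He]; auto. }
  apply sp_and; now apply sp_imp.
Qed.

(** A Rocq function on variables need not respect [=]; [stratP] supplies an underlying formula, in
    which equals may be substituted. *)
Lemma leib {G} (P : V -> prop) x y : stratP P -> (G ⊩ x = y) -> (G ⊩ P x) -> G ⊩ P y.
Proof.
  intros [a [A [_ H]]] Hxy Hx.
  apply (H [x]) in Hx; auto. apply (H [y]); auto.
  apply force_iff in Hx. apply force_iff. revert Hxy Hx. apply nd_leib.
Qed.

(** The axiom is taken for the deep formula, where copies of one parameter at different types are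
    distinct variables. Renaming along [env []] then identifies these copies, as [nd_valid_ren]
    permits for an instance of a universally closed axiom. *)
Lemma compr G (P : V -> prop) : stratP P -> G ⊩ ∃ s, spec s P.
Proof.
  intros [a [A [HA H]]].
  assert (K : G ⊩ force (env []) (comprehension A)).
  { apply force_iff, nd_valid_ren. intros G'. apply nd_ax, INF_compr. now exists (tenv [a]). }
  apply (exE _ K); clear K; intros G' s _ K; apply (exI s); intros t.
  assert (E : forall G, (G ⊩ force (scons t (scons s (env []))) (ren (up S) A)) <-> (G ⊩ P t)).
  { intros G2. rewrite force_iff, ren_ren, (ren_ext _ (env [t])), <- force_iff.
    - symmetry; now apply (H [t]).
    - intros [|]; reflexivity. }
  destruct (K t) as [K1 K2]; split; intros G2 Hi X.
  - apply E, K1; auto.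
  - apply K2, E; auto.
Qed.

Lemma ext {G} x y : (G ⊩ ∀ t, t ∈ x ⇔ t ∈ y) -> G ⊩ x = y.
Proof.
  intros H. assert (K : G ⊩ force (env []) extensionality).
  { apply force_iff, nd_valid_ren. intros G'. apply nd_ax, INF_ext. }
  exact (impE (K x y) H).
Qed.

(** * Tactics for reasoning at a world *)

Arguments at_ : simpl never.

(** Moves every hypothesis to the larger context, so that proofs read as if there were one current
    world. *)
Ltac up s :=
  match type of s with incl ?G ?G' =>
    repeat match goal with H : at_ ?P G |- _ => apply (mono P G G' s) in H end;
    clear s; try (clear G; rename G' into G)
  end.

Ltac kimp := let G' := fresh "G'" in let s := fresh in let H := fresh "H" in
  intros G' s H; up s; revert H.

Tactic Notation "ki" simple_intropattern(p) := kimp; intros p.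

Tactic Notation "kex" constr(H) "as" ident(x) simple_intropattern(p) :=
  let G' := fresh "G'" in let s := fresh in let K := fresh "K" in
  refine (exE _ H _); try clear H; intros G' x s K; up s; revert K; intros p.

Tactic Notation "kor" constr(H) "as" simple_intropattern(p) "|" simple_intropattern(q) :=
  let G' := fresh "G'" in let s := fresh in let K := fresh "K" in
  refine (orE _ H _ _); try clear H; intros G' s K; up s; revert K; [intros p|intros q].

Create HintDb strat.

Ltac sv :=
  let rec go k := first [eapply (sv_nth k); simpl; reflexivity | lazymatch k with 12 => fail | _ => go (S k) end] in
  first [apply sv_const | go 0].

Ltac sp := cbv beta; lazymatch goal with
  | |- spred _ (fun e => kMem _ _) => eapply sp_mem; sv
  | |- spred _ (fun e => kEq _ _) => eapply sp_eq; sv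
  | |- spred _ (fun e => kBot) => apply sp_bot
  | |- spred _ (fun e => kAnd _ _) => apply sp_and; sp
  | |- spred _ (fun e => kOr _ _) => apply sp_or; sp
  | |- spred _ (fun e => kImp _ _) => apply sp_imp; sp
  | |- spred _ (fun e => kNot _) => unfold kNot at 1; sp
  | |- spred _ (fun e => kIff _ _) => unfold kIff at 1; sp
  | |- spred ?t (fun e => kAll (@?P e)) => eapply (sp_all t _ P); sp
  | |- spred ?t (fun e => kEx (@?P e)) => eapply (sp_ex t _ P); sp
  | |- spred ?t (fun e => spec (@?s e) (@?P e)) => eapply (sp_spec t _ s P); [sv|sp]
  | _ => progress autounfold with strat; sp
  end.

(** Unification finds the types; those left undetermined are set to 0. *)
Ltac strat := unshelve (eexists; sp); exact 0.

Lemma keq_sym {G} x y : (G ⊩ x = y) -> G ⊩ y = x.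
Proof. intros H. apply (leib (fun z => z = x)%k x y); [strat|auto|apply keq_refl]. Qed.

Ltac ksubst_at H K :=
  match type of H with at_ (kEq ?x ?y) _ =>
  match type of K with at_ ?X _ =>
    let P := eval pattern x in X in
    match P with ?f _ => apply (leib f x y ltac:(strat) H) in K; cbv beta in K end end end.

Ltac ksubst H :=
  match type of H with at_ (kEq ?x ?y) ?G =>
    repeat match goal with K : at_ ?X G |- _ =>
      lazymatch K with H => fail | _ => idtac end;
      lazymatch X with context [x] => ksubst_at H K end end;
    try match goal with |- at_ ?X G =>
      lazymatch X with context [x] =>
        let P := eval pattern x in X in
        match P with ?f _ => refine (leib f y x ltac:(strat) (keq_sym _ _ H) _); cbv beta end end end;
    clear H; try clear x end.

Lemma specE {G s P} : (G ⊩ spec s P) -> forall t, (G ⊩ t ∈ s) <-> (G ⊩ P t).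
Proof. intros H t; apply iffE, H. Qed.

Lemma spec_ext {G s s' P} : (G ⊩ spec s P) -> (G ⊩ spec s' P) -> G ⊩ s = s'.
Proof.
  intros H H'; apply ext; intros t; split; ki K.
  - now apply (specE H'), (specE H).
  - now apply (specE H), (specE H').
Qed.

Ltac kstep := match goal with
  | H : at_ ?P ?G |- at_ ?P ?G => exact H
  | |- at_ (kEq ?x ?x) _ => apply keq_refl
  | H : at_ (kEq ?x ?y) ?G |- at_ (kEq ?y ?x) ?G => exact (keq_sym _ _ H)
  | H : at_ kBot _ |- _ => exact (botE _ H)
  | H : at_ (kNot ?P) ?G, K : at_ ?P ?G |- _ => exact (botE _ (impE H K))
  | |- at_ (kAll _) _ => intro
  | |- at_ (spec _ _) _ => intro
  | |- at_ (kNot _) _ => kimp; intro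
  | |- at_ (kImp _ _) _ => kimp; intro
  | |- at_ (kIff _ _) _ => split
  | |- at_ (kAnd _ _) _ => split
  | H : at_ (kAnd _ _) _ |- _ => let H1 := fresh in let H2 := fresh in destruct H as [H1 H2]
  | H : at_ (kEx _) _ |- _ => let x := fresh "x" in kex H as x ?
  | H : at_ (kOr _ _) _ |- _ => kor H as ? | ?
  | H : at_ (kMem ?t ?s) ?G, K : at_ (spec ?s ?P) ?G |- _ => apply (specE K t) in H; cbv beta in H
  | K : at_ (spec ?s ?P) ?G |- at_ (kMem ?t ?s) ?G => apply (specE K t); cbv beta
  | H : at_ (kEq _ _) _ |- _ => ksubst H
  end.

Ltac kauto := repeat kstep; try match goal with
  | |- at_ (kOr _ _) _ => first [solve [apply orI1; kauto] | solve [apply orI2; kauto]]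
  end; try match goal with
  | H : at_ (kNot ?P) _ |- _ => solve [apply botE; apply (impE H); clear H; kauto]
  end.

Tactic Notation "kset" ident(s) ident(H) uconstr(P) :=
  let G' := fresh "G'" in let i := fresh in
  match goal with |- at_ _ ?G =>
  refine (exE _ (compr G P ltac:(strat)) _); intros G' s i H; up i end.

(** * Finite Frege cardinals *)

Notation isEmpty e := (spec e (fun _ => kBot)).
Notation isAdd v u c := (spec v (fun t => t ∈ u ∨ t = c)%k).
Notation isZero z := (spec z (fun e => isEmpty e)).
Notation succMem v x := (∃ u c, u ∈ x ∧ c ∉ u ∧ isAdd v u c)%k.
Notation isSucc y x := (spec y (fun v => succMem v x)).

Lemma add_new {G v u c} : (G ⊩ isAdd v u c) -> G ⊩ c ∈ v.
Proof. intros H. apply (specE H), orI2, keq_refl. Qed.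

Lemma add_old {G v u c t} : (G ⊩ isAdd v u c) -> (G ⊩ t ∈ u) -> G ⊩ t ∈ v.
Proof. intros H K. now apply (specE H), orI1. Qed.

Lemma add_remove {G v u c} : (G ⊩ isAdd v u c) -> (G ⊩ c ∉ u) ->
  G ⊩ spec u (fun t => t ∈ v ∧ t ≠ c)%k.
Proof. intros H K. kauto. Qed.

(** The shape follows the elimination of class abstracts in [fregeF] literally, so that
    [rosser_force] holds by computation. *)
Definition inF (n : V) : prop :=
  ∀ w, (∃ z, isZero z ∧ z ∈ w) ∧
       (∀ x, x ∈ w ∧ (∃ v, succMem v x) ⇒ ∃ s, isSucc s x ∧ s ∈ w) ⇒ n ∈ w.

Definition sub (a b : V) : prop := ∀ t, t ∈ a ⇒ t ∈ b.
Definition sep (a b : V) : prop := sub a b ∧ spec b (fun t => t ∈ a ∨ (t ∈ b ∧ t ∉ a))%k.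
Definition cardle (x y : V) : prop := ∃ a b, a ∈ x ∧ b ∈ y ∧ sep a b.
Notation below y := (fun z => inF z ∧ cardle z y ∧ z ≠ y)%k.
Definition theta (x y : V) : prop := ∃ s, spec s (below y) ∧ s ∈ x.
#[local] Hint Unfold inF sub sep cardle theta : strat.

Definition rosser : prop := ∀ x, inF x ⇒ theta x x.

Lemma rosser_force e G : (G ⊩ force e (rosser_counting 0)) = (G ⊩ rosser).
Proof. cbv -[at_ kMem kEq kAnd kOr kImp kAll kEx kBot]; reflexivity. Qed.

Lemma F_zero {G z} : (G ⊩ isZero z) -> G ⊩ inF z.
Proof.
  intros Hz w; ki [H _]. kex H as z' [H1 H2].
  assert (K := spec_ext H1 Hz). kauto.
Qed.

Lemma F_succ {G x y} : (G ⊩ inF x) -> (G ⊩ isSucc y x) -> (G ⊩ ∃ v, v ∈ y) -> G ⊩ inF y.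
Proof.
  intros Hx Hy Hv w; ki H.
  assert (K : G ⊩ ∃ s, isSucc s x ∧ s ∈ w).
  { apply (impE (proj2 H x)). split; [exact (impE (Hx w) H)|].
    kex Hv as v Hv. apply (exI v). now apply (specE Hy). }
  kex K as s [K1 K2]. assert (E := spec_ext K1 Hy). kauto.
Qed.

(** Comprehension is applied to the conjunction with [inF x], which makes [inF x] available in the
    successor step. *)
Lemma F_ind (D : V -> prop) {G} : stratP (fun x => inF x ∧ D x)%k ->
  (G ⊩ ∀ z, isZero z ⇒ D z) ->
  (G ⊩ ∀ x y, inF x ⇒ isSucc y x ⇒ (∃ v, v ∈ y) ⇒ D x ⇒ D y) ->
  G ⊩ ∀ x, inF x ⇒ D x.
Proof.
  intros HD H0 H1 x; ki Hx.
  refine (exE _ (compr G _ HD) _); intros G' w s Hw; up s.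
  assert (K : G ⊩ x ∈ w).
  { apply (impE (Hx w)). split.
    - kset z Hz (fun e => isEmpty e)%k. apply (exI z). split; auto.
      apply (specE Hw). split; [now apply F_zero|exact (impE (H0 z) Hz)].
    - intros y; ki [Hy Hv]. apply (specE Hw) in Hy. destruct Hy as [Hy HDy].
      kset s Hs (fun v => succMem v y). apply (exI s). split; auto.
      assert (Hv' : G ⊩ ∃ v, v ∈ s) by (kex Hv as v Hv; apply (exI v), (specE Hs), Hv).
      apply (specE Hw). split; [now apply (F_succ Hy)|].
      exact (impE (impE (impE (impE (H1 y s) Hy) Hs) Hv') HDy). }
  now apply (specE Hw) in K as [].
Qed.

Lemma F_inv {G} : G ⊩ ∀ x, inF x ⇒ isZero x ∨ ∃ y, inF y ∧ isSucc x y.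
Proof.
  apply F_ind; [strat|..].
  - intros z; ki H. now apply orI1.
  - intros x y; ki Hx; ki Hy; ki Hv; ki _. apply orI2, (exI x). now split.
Qed.

(** * Finite sets: decidable equality, exchange of elements, disjointness of cardinals *)

Notation "f ∙ x" := (impE f x) (at level 11, left associativity).
Notation "f ⋅ x" := (impE (f _) x) (at level 11, left associativity).

(** The element added at a successor is outside the old set, hence distinct from all old
    elements. *)
Lemma F_dec {G} : G ⊩ ∀ x, inF x ⇒ ∀ u, u ∈ x ⇒ ∀ t, t ∈ u ⇒ ∀ s, s ∈ u ⇒ t = s ∨ t ≠ s.
Proof.
  apply F_ind; [strat|..].
  - intros z; ki H. kauto.
  - intros x y; ki Hx; ki Hy; ki _; ki IH. intros u; ki Hu.
    apply (specE Hy) in Hu. kex Hu as v Hu. kex Hu as c [A [B C]].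
    intros t; ki Ht; intros s; ki Hs. apply (specE C) in Ht, Hs.
    kor Ht as Ht|Ht; kor Hs as Hs|Hs; try (kauto; fail).
    exact (IH ⋅ A ⋅ Ht ⋅ Hs).
Qed.

Notation isSwap r v a b := (spec r (fun t => (t ∈ v ∧ t ≠ a) ∨ t = b)%k).

(** If [a] is an old element, exchange it inside the smaller set and add [c] again; if [a] is the
    last element added, add [b] in its place. *)
Lemma F_swap {G} : G ⊩ ∀ x, inF x ⇒ ∀ v, v ∈ x ⇒ ∀ a, a ∈ v ⇒ ∀ b, b ∉ v ⇒
  ∀ r, isSwap r v a b ⇒ r ∈ x.
Proof.
  apply F_ind; [strat|..].
  - intros z; ki H. kauto.
  - intros x y; ki Hx; ki Hy; ki _; ki IH. intros v; ki Hv.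
    apply (specE Hy) in Hv. kex Hv as w Hv. kex Hv as c [A [B C]].
    intros a; ki Ha; intros b; ki Hb; intros r; ki Hr. apply (specE Hy).
    apply (specE C) in Ha. kor Ha as Ha|Ha.
    + kset q Hq (fun t => (t ∈ w ∧ t ≠ a) ∨ t = b)%k.
      assert (Hbw : G ⊩ b ∉ w) by kauto.
      assert (K := IH ⋅ A ⋅ Ha ⋅ Hbw ⋅ Hq).
      apply (exI q), (exI c). split; [auto|]. split.
      * kauto.
      * kauto.
    + apply (exI w), (exI b). split; [auto|]. split; kauto.
Qed.

(** Removing an old element [c] amounts to exchanging it for the last element [d] in the smaller
    set. *)
Lemma succ_remove {G x y b c r} : (G ⊩ inF x) -> (G ⊩ isSucc y x) -> (G ⊩ b ∈ y) ->
  (G ⊩ c ∈ b) -> (G ⊩ spec r (fun t => t ∈ b ∧ t ≠ c)%k) -> G ⊩ r ∈ x.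
Proof.
  intros Hx Hy Hb Hc Hr. apply (specE Hy) in Hb. kex Hb as v Hv. kex Hv as d [A [B C]].
  apply (specE C) in Hc. kor Hc as Hc|Hc.
  - assert (Hs : G ⊩ isSwap r v c d) by kauto.
    exact (F_swap ⋅ Hx ⋅ A ⋅ Hc ⋅ B ⋅ Hs).
  - assert (E : G ⊩ v = r) by (apply ext; kauto). now ksubst E.
Qed.

Lemma empty_succ {G u x} (R : prop) : (G ⊩ isEmpty u) -> (G ⊩ succMem u x) -> G ⊩ R.
Proof.
  intros Hu H. kex H as v H. kex H as c [_ [_ H]].
  exact (botE _ (proj1 (specE Hu c) (add_new H))).
Qed.

(** Removing the same element [c] from the common member [u] leaves a common member of the two
    predecessors. *)
Lemma F_disjoint {G} : G ⊩ ∀ x, inF x ⇒ ∀ u, u ∈ x ⇒ ∀ y, inF y ⇒ u ∈ y ⇒ x = y.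
Proof.
  apply F_ind; [strat|..].
  - intros z; ki Hz; intros u; ki Hu; intros y; ki Hy; ki Hu'.
    kor (F_inv ⋅ Hy) as K|K.
    + exact (spec_ext Hz K).
    + kex K as y0 [_ K].
      exact (empty_succ _ (proj1 (specE Hz _) Hu) (proj1 (specE K _) Hu')).
  - intros x y; ki Hx; ki Hy; ki _; ki IH. intros u; ki Hu; intros y'; ki Hy'; ki Hu'.
    apply (specE Hy) in Hu. kex Hu as v Hu. kex Hu as c [A [B C]].
    kor (F_inv ⋅ Hy') as K|K.
    + apply (specE K) in Hu'. apply (empty_succ (x := x) _ Hu').
      apply (exI v), (exI c). exact (conj A (conj B C)).
    + kex K as x' [K K'].
      assert (E := IH ⋅ A ⋅ K ∙ (succ_remove K K' Hu' (add_new C) (add_remove C B))).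
      ksubst E. exact (spec_ext Hy K').
Qed.

Lemma succ_inj {G x x' y v} : (G ⊩ inF x) -> (G ⊩ inF x') ->
  (G ⊩ isSucc y x) -> (G ⊩ isSucc y x') -> (G ⊩ v ∈ y) -> G ⊩ x = x'.
Proof.
  intros Hx Hx' Hy Hy' Hv. assert (Hv' := Hv). apply (specE Hy) in Hv.
  kex Hv as u Hv. kex Hv as c [A [B C]].
  exact (F_disjoint ⋅ Hx ⋅ A ⋅ Hx' ∙ (succ_remove Hx' Hy' Hv' (add_new C) (add_remove C B))).
Qed.

(** * Separable subsets and the order on finite cardinals *)

Lemma sepE {G a b t} : (G ⊩ sep a b) -> (G ⊩ t ∈ b) -> G ⊩ t ∈ a ∨ t ∉ a.
Proof. intros [_ H] Ht. apply (specE H) in Ht. clear H. kauto. Qed.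

Lemma sepI {G a b} : (G ⊩ sub a b) -> (G ⊩ ∀ t, t ∈ b ⇒ t ∈ a ∨ t ∉ a) -> G ⊩ sep a b.
Proof.
  intros H K. split; auto. intros t; split.
  - ki Ht. kor (K ⋅ Ht) as ?|?; kauto.
  - ki Ht. kor Ht as Ht|Ht; [exact (H ⋅ Ht)|kauto].
Qed.

(** Separability decides whether the last element [c] lies in [a]. If not, [c] is the witness; if
    so, the question passes to the trace of [a] on the smaller set. *)
Lemma F_sep {G} : G ⊩ ∀ y, inF y ⇒ ∀ b, b ∈ y ⇒ ∀ a, sep a b ⇒ a = b ∨ ∃ d, d ∈ b ∧ d ∉ a.
Proof.
  apply F_ind; [strat|..].
  - intros z; ki Hz; intros b; ki Hb; intros a; ki Ha. apply (specE Hz) in Hb.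
    apply orI1, ext. intros t; split; ki Ht; [exact (proj1 Ha ⋅ Ht)|kauto].
  - intros x y; ki Hx; ki Hy; ki _; ki IH. intros b; ki Hb; intros a; ki Ha.
    apply (specE Hy) in Hb. kex Hb as v Hb. kex Hb as c [A [B C]].
    kor (sepE Ha (add_new C)) as K|K.
    + kset q Hq (fun t => t ∈ a ∧ t ∈ v)%k.
      assert (Hqv : G ⊩ sep q v).
      { apply sepI; [intros t; kauto|]. intros t; ki Ht.
        assert (Htb : G ⊩ t ∈ b) by kauto. kor (sepE Ha Htb) as L|L; kauto. }
      kor (IH ⋅ A ⋅ Hqv) as E|E.
      * apply orI1, ext; intros t; split; ki Ht; [exact (proj1 Ha ⋅ Ht)|].
        apply (specE C) in Ht. kor Ht as Ht|Ht; [|kauto].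
        apply (leib (fun z => t ∈ z)%k _ _ ltac:(strat) (keq_sym _ _ E)) in Ht. kauto.
      * kex E as d [E1 E2]. apply orI2, (exI d). kauto.
    + apply orI2, (exI c). kauto.
Qed.

Lemma sep_refl {G a} : G ⊩ sep a a.
Proof. apply sepI; [intros t|intros t; ki Ht; apply orI1]; kauto. Qed.

Lemma sep_add {G a v b c} : (G ⊩ sep a v) -> (G ⊩ c ∉ v) -> (G ⊩ isAdd b v c) -> G ⊩ sep a b.
Proof.
  intros S Hc Hb. apply sepI.
  - intros t; ki Ht. exact (add_old Hb (proj1 S ⋅ Ht)).
  - intros t; ki Ht. apply (specE Hb) in Ht. kor Ht as Ht|Ht.
    + exact (sepE S Ht).
    + apply orI2. ki Hta. assert (K := proj1 S ⋅ Hta). kauto.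
Qed.

Lemma sep_drop {G a v b c} : (G ⊩ sep a b) -> (G ⊩ c ∉ a) -> (G ⊩ isAdd b v c) -> G ⊩ sep a v.
Proof.
  intros S Hc Hb. apply sepI.
  - intros t; ki Ht. assert (K := proj1 S ⋅ Ht). kauto.
  - intros t; ki Ht. exact (sepE S (add_old Hb Ht)).
Qed.

Lemma le_succ_inv {G x y z} : (G ⊩ inF x) -> (G ⊩ isSucc y x) -> (G ⊩ inF y) -> (G ⊩ inF z) ->
  (G ⊩ cardle z y) -> G ⊩ cardle z x ∨ z = y.
Proof.
  intros Hx Hs Hy Hz H. kex H as a H. kex H as b [Ha [Hb S]].
  assert (Hb' := Hb). apply (specE Hs) in Hb'. kex Hb' as v Hb'. kex Hb' as c [A [B C]].
  kor (sepE S (add_new C)) as K|K.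
  2: { apply orI1, (exI a), (exI v). exact (conj Ha (conj A (sep_drop S K C))). }
  kset q Hq (fun t => t ∈ a ∧ t ∈ v)%k.
  assert (Hqv : G ⊩ sep q v).
  { apply sepI; [intros t; kauto|]. intros t; ki Ht.
    kor (sepE S (add_old C Ht)) as L|L; kauto. }
  kor (F_sep ⋅ Hx ⋅ A ⋅ Hqv) as E|E.
  - assert (E' : G ⊩ a = b).
    { apply ext; intros t; split; ki Ht; [exact (proj1 S ⋅ Ht)|].
      apply (specE C) in Ht. kor Ht as Ht|Ht; [|kauto].
      apply (leib (fun z => t ∈ z)%k _ _ ltac:(strat) (keq_sym _ _ E)) in Ht. kauto. }
    clear S. ksubst E'. apply orI2. exact (F_disjoint ⋅ Hz ⋅ Ha ⋅ Hy ∙ Hb).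
  (* Here [a] contains [c] but misses some [d] of [v]. Exchanging [c] for [d] yields a member of [z]
     inside [v]; [F_dec] makes it separable there. *)
  - kex E as d [D1 D2]. assert (D3 : G ⊩ d ∉ a) by (clear S; kauto).
    kset r Hr (fun t => (t ∈ a ∧ t ≠ c) ∨ t = d)%k.
    apply orI1, (exI r), (exI v).
    split; [exact (F_swap ⋅ Hz ⋅ Ha ⋅ K ⋅ D3 ⋅ Hr)|]. split; [auto|]. apply sepI.
    + intros t; ki Ht. apply (specE Hr) in Ht. kor Ht as [Ht Hn]|Ht.
      * assert (Htb := proj1 S ⋅ Ht). clear Hb. kauto.
      * kauto.
    + intros t; ki Ht. kor (sepE S (add_old C Ht)) as L|L.
      * apply orI1. kauto.
      * kor (F_dec ⋅ Hx ⋅ A ⋅ Ht ⋅ D1) as M|M; [apply orI1|apply orI2]; kauto.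
Qed.

(** Frees [cardle] from the representative of [y] that happened to witness it, so that comparisons
    can be continued through a chosen [b]. *)
Lemma le_uniform {G} : G ⊩ ∀ y, inF y ⇒ ∀ z, inF z ⇒ cardle z y ⇒
  ∀ b, b ∈ y ⇒ ∃ a, a ∈ z ∧ sep a b.
Proof.
  apply F_ind; [strat|..].
  - intros y; ki Hy; intros z; ki _; ki H; intros b; ki Hb.
    kex H as a H. kex H as b' [H1 [H2 H3]]. apply (exI a); split; auto.
    apply (specE Hy) in Hb, H2. assert (E := spec_ext H2 Hb). now ksubst E.
  - intros x y; ki Hx; ki Hs; ki Hi; ki IH. intros z; ki Hz; ki H; intros b; ki Hb.
    kor (le_succ_inv Hx Hs (F_succ Hx Hs Hi) Hz H) as K|E.
    + apply (specE Hs) in Hb. kex Hb as v Hb. kex Hb as c [A [B C]].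
      assert (L := IH ⋅ Hz ∙ K ⋅ A). kex L as a [L M].
      apply (exI a). exact (conj L (sep_add M B C)).
    + apply (exI b). ksubst E. exact (conj Hb sep_refl).
Qed.

(** Removing one element [c] from both the subset and the set lowers both cardinals by one. *)
Lemma succ_not_le {G} : G ⊩ ∀ x, inF x ⇒ ∀ y, isSucc y x ⇒ kNot (cardle y x).
Proof.
  apply F_ind; [strat|..].
  - intros z; ki Hz; intros y; ki Hy; ki H. kex H as a H. kex H as b [H1 [H2 H3]].
    apply (specE Hz) in H2. apply (specE Hy) in H1. kex H1 as v H1. kex H1 as c [A [B C]].
    assert (K := proj1 H3 ⋅ (add_new C)). exact (proj1 (specE H2 c) K).
  - intros x y; ki Hx; ki Hs; ki _; ki IH. intros y'; ki Hy'; ki H.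
    kex H as a H. kex H as b [H1 [H2 H3]].
    apply (specE Hy') in H1. kex H1 as v H1. kex H1 as c [A [B C]].
    kset r Hr (fun t => t ∈ b ∧ t ≠ c)%k.
    assert (K := succ_remove Hx Hs H2 (proj1 H3 ⋅ (add_new C)) Hr).
    apply (impE (IH ⋅ Hs)). apply (exI v), (exI r). split; [auto|]. split; [auto|].
    apply sepI.
    + intros t; ki Ht. assert (Htb := proj1 H3 ⋅ (add_old C Ht)). kauto.
    + intros t; ki Ht. apply (specE Hr) in Ht. destruct Ht as [Ht Hn].
      kor (sepE H3 Ht) as L|L; clear H2; kauto.
Qed.

Lemma lt_succ {G x y z} : (G ⊩ inF x) -> (G ⊩ isSucc y x) -> (G ⊩ ∃ v, v ∈ y) -> (G ⊩ inF z) ->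
  (G ⊩ cardle z y ∧ z ≠ y) <-> (G ⊩ (cardle z x ∧ z ≠ x) ∨ z = x).
Proof.
  intros Hx Hs Hi Hz. split.
  - intros [H Hn]. kor (le_succ_inv Hx Hs (F_succ Hx Hs Hi) Hz H) as K|K; [|kauto].
    kex K as a K. kex K as b [K1 [K2 K3]].
    kor (F_sep ⋅ Hx ⋅ K2 ⋅ K3) as E|E.
    + apply orI2. ksubst E. exact (F_disjoint ⋅ Hz ⋅ K1 ⋅ Hx ∙ K2).
    + apply orI1. kex E as d [D1 D2]. split.
      * apply (exI a), (exI b). exact (conj K1 (conj K2 K3)).
      (* If [z = x], adding [d] to [a] gives a member of [y] that is still a separable subset of
         [b], a member of [x]. *)
      * ki E. apply (impE (succ_not_le ⋅ Hx ⋅ Hs)).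
        kset r Hr (fun t => t ∈ a ∨ t = d)%k. apply (exI r), (exI b).
        split; [apply (specE Hs), (exI a), (exI d); ksubst E; exact (conj K1 (conj D2 Hr))|].
        split; [auto|]. apply sepI.
        -- intros t; ki Ht. apply (specE Hr) in Ht. kor Ht as Ht|Ht; [exact (proj1 K3 ⋅ Ht)|].
           clear K3. now ksubst Ht.
        -- intros t; ki Ht. kor (sepE K3 Ht) as L|L; [apply orI1, (add_old Hr L)|].
           kor (F_dec ⋅ Hx ⋅ K2 ⋅ Ht ⋅ D1) as M|M; [apply orI1|apply orI2; clear K2 K1]; kauto.
  - intros H. assert (Hn : G ⊩ kNot (cardle y x)) by exact (succ_not_le ⋅ Hx ⋅ Hs).
    assert (K : G ⊩ cardle z x).
    { kor H as [H _]|E; auto. ksubst E. kex Hi as v Hi. apply (specE Hs) in Hi.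
      kex Hi as u Hi. kex Hi as c [A _]. apply (exI u), (exI u). exact (conj A (conj A sep_refl)). }
    split.
    + kex Hi as b Hi. assert (Hi' := Hi). apply (specE Hs) in Hi'.
      kex Hi' as v Hi'. kex Hi' as c [A [B C]].
      assert (L := le_uniform ⋅ Hx ⋅ Hz ∙ K ⋅ A). kex L as a [L M].
      apply (exI a), (exI b). exact (conj L (conj Hi (sep_add M B C))).
    + ki E. ksubst E. exact (Hn ∙ K).
Qed.

(** * The relation [theta] and the consequences of Rosser's axiom *)

Lemma theta_succ {G x x' y y'} : (G ⊩ inF y) -> (G ⊩ isSucc y' y) -> (G ⊩ ∃ v, v ∈ y') ->
  (G ⊩ isSucc x' x) -> (G ⊩ theta x y) -> (G ⊩ theta x' y').
Proof.
  (* By [lt_succ] the initial segment below [y'] is the one below [y] with the new element [y],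
     which is not below itself. *)
  intros Hy Hs Hi Hx H. kex H as s [H1 H2]. kset r Hr (fun t => t ∈ s ∨ t = y)%k.
  apply (exI r). split.
  - intros z; split; ki K.
    + apply (specE Hr) in K. kor K as K|K.
      * apply (specE H1) in K. destruct K as [K1 K2]. split; auto.
        apply (lt_succ Hy Hs Hi K1). now apply orI1.
      * assert (Hz : G ⊩ inF z) by now ksubst K.
        split; auto. apply (lt_succ Hy Hs Hi Hz). now apply orI2.
    + destruct K as [K1 K2]. apply (lt_succ Hy Hs Hi K1) in K2. apply (specE Hr).
      kor K2 as K2|K2; [apply orI1, (specE H1)|apply orI2]; auto. split; auto.
  - apply (specE Hx), (exI s), (exI y). split; [auto|]. split; [|auto].
    ki K. apply (specE H1) in K. destruct K as [_ [_ K]]. kauto.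
Qed.

Lemma theta_fun {G x x' y} : (G ⊩ inF x) -> (G ⊩ inF x') ->
  (G ⊩ theta x y) -> (G ⊩ theta x' y) -> G ⊩ x = x'.
Proof.
  intros Hx Hx' H H'. kex H as s [H1 H2]. kex H' as s' [H1' H2'].
  assert (E := spec_ext H1 H1'). ksubst E. exact (F_disjoint ⋅ Hx ⋅ H2 ⋅ Hx' ∙ H2').
Qed.

Lemma rosser_succ {G} : (G ⊩ rosser) -> G ⊩ ∀ x, inF x ⇒ ∀ y, isSucc y x ⇒ ∃ v, v ∈ y.
Proof.
  intros H x; ki Hx; intros y; ki Hy. assert (K := H ⋅ Hx). kex K as s [K1 K2].
  kset v Hv (fun t => t ∈ s ∨ t = x)%k.
  apply (exI v), (specE Hy), (exI s), (exI x). split; [auto|]. split; [|auto].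
  ki L. apply (specE K1) in L. destruct L as [_ [_ L]]. kauto.
Qed.

(** * Pairs *)

(** The coordinates are given by their elementhood conditions, since in the Church numbers they may
    be class abstracts; [spec_name] and [pairP_cong] replace such an abstract by an individual. *)
Definition pairP (p : V) (X Y : V -> prop) : prop :=
  spec p (fun t => spec t X ∨ spec t (fun s => X s ∨ Y s))%k.
Notation isPair p x y := (pairP p (fun t => t = x)%k (fun t => t = y)%k).
Definition pmem (x y f : V) : prop := ∃ p, isPair p x y ∧ p ∈ f.
Definition func (f : V) : prop := ∀ x y z, pmem x y f ⇒ pmem x z f ⇒ y = z.

#[local] Hint Unfold pairP pmem func : strat.

Lemma pair_ex {G} x y : G ⊩ ∃ p, isPair p x y.
Proof. apply compr; strat. Qed.

Lemma pair_inj {G p x y x' y'} : (G ⊩ isPair p x y) -> (G ⊩ isPair p x' y') ->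
  G ⊩ x = x' ∧ y = y'.
Proof.
  intros H H'.
  assert (Hx : G ⊩ x = x').
  { kset s Hs (fun t => t = x)%k.
    assert (K : G ⊩ s ∈ p) by now apply (specE H), orI1.
    assert (Kx : G ⊩ x ∈ s) by kauto.
    apply (specE H') in K. kor K as K|K.
    - now apply (specE K) in Kx.
    - assert (L : G ⊩ x' ∈ s) by (apply (specE K), orI1, keq_refl).
      apply (specE Hs) in L. now apply keq_sym. }
  split; auto. ksubst Hx.
  kset d Hd (fun t => t = x' ∨ t = y)%k. kset d' Hd' (fun t => t = x' ∨ t = y')%k.
  assert (K : G ⊩ d ∈ p) by now apply (specE H), orI2.
  assert (K' : G ⊩ d' ∈ p) by now apply (specE H'), orI2.
  assert (Ky : G ⊩ y ∈ d) by (apply (specE Hd), orI2, keq_refl).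
  assert (Ky' : G ⊩ y' ∈ d') by (apply (specE Hd'), orI2, keq_refl).
  apply (specE H') in K. apply (specE H) in K'.
  assert (E : G ⊩ y = x' ∨ y = y').
  { kor K as K|K; [apply orI1|]; now apply (specE K) in Ky. }
  assert (E' : G ⊩ y' = x' ∨ y' = y).
  { kor K' as K'|K'; [apply orI1|]; now apply (specE K') in Ky'. }
  (* In the only case without a direct equation, [y] and [y'] both equal [x']. *)
  clear - E E'. kauto.
Qed.

Lemma spec_cong {G s P Q} : (G ⊩ ∀ t, P t ⇔ Q t) -> (G ⊩ spec s P) -> G ⊩ spec s Q.
Proof.
  intros H K t. specialize (H t). specialize (K t). split; ki L.
  - now apply (iffE H), (iffE K).
  - now apply (iffE K), (iffE H).
Qed.

Lemma pairP_cong {G p X X' Y Y'} : (G ⊩ ∀ t, X t ⇔ X' t) -> (G ⊩ ∀ t, Y t ⇔ Y' t) ->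
  (G ⊩ pairP p X Y) -> G ⊩ pairP p X' Y'.
Proof.
  intros HX HY. apply spec_cong. intros t.
  assert (HX' : G ⊩ ∀ t, X' t ⇔ X t) by (intros u; destruct (HX u); now split).
  assert (HY' : G ⊩ ∀ t, Y' t ⇔ Y t) by (intros u; destruct (HY u); now split).
  assert (K : forall A A' B B' : V -> prop, (G ⊩ ∀ t, A t ⇔ A' t) -> (G ⊩ ∀ t, B t ⇔ B' t) ->
    G ⊩ ∀ t, A t ∨ B t ⇒ A' t ∨ B' t).
  { intros A A' B B' HA HB u; specialize (HA u); specialize (HB u). ki H.
    kor H as H|H; [apply orI1, (iffE HA), H|apply orI2, (iffE HB), H]. }
  assert (KX := K X X' Y Y' HX HY). assert (KX' := K X' X Y' Y HX' HY').
  assert (HXY : G ⊩ ∀ t, X t ∨ Y t ⇔ X' t ∨ Y' t) by (intros u; split; [apply KX|apply KX']).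
  assert (HXY' : G ⊩ ∀ t, X' t ∨ Y' t ⇔ X t ∨ Y t) by (intros u; split; [apply KX'|apply KX]).
  clear K KX KX' HY HY'.
  split; ki H; kor H as H|H.
  - apply orI1. exact (spec_cong HX H).
  - apply orI2. exact (spec_cong HXY H).
  - apply orI1. exact (spec_cong HX' H).
  - apply orI2. exact (spec_cong HXY' H).
Qed.

Lemma spec_name {G q Q} : (G ⊩ spec q Q) -> G ⊩ ∀ t, spec t Q ⇔ t = q.
Proof.
  intros H t; split; ki K; [exact (spec_ext K H)|].
  apply keq_sym in K. intros u; split; ki L.
  - apply (specE H). eapply (leib (fun z => u ∈ z)%k t q); [strat|now apply keq_sym|auto].
  - apply (leib (fun z => u ∈ z)%k q t); [strat|auto|now apply (specE H)].
Qed.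

Lemma name_spec {G q Q} : (G ⊩ spec q Q) -> G ⊩ ∀ t, t = q ⇔ spec t Q.
Proof. intros H t; destruct (spec_name H t); now split. Qed.

Lemma kiff_refl {G} (P : V -> prop) : G ⊩ ∀ t, P t ⇔ P t.
Proof. intros t; split; now ki H. Qed.

(** [Q] is an arbitrary function on individuals, so the coordinates are not rewritten here; the
    equalities are left for a caller that knows a stratified form. *)
Lemma pmem_spec {G f x y} {Q : V -> V -> prop} :
  (G ⊩ spec f (fun u => ∃ a b, isPair u a b ∧ Q a b)%k) -> (G ⊩ pmem x y f) ->
  G ⊩ ∃ a b, x = a ∧ y = b ∧ Q a b.
Proof.
  intros H K. kex K as p [K1 K2]. apply (specE H) in K2. kex K2 as a K2. kex K2 as b [K2 K3].
  apply (exI a), (exI b). destruct (pair_inj K1 K2) as [E1 E2]. exact (conj E1 (conj E2 K3)).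
Qed.

Lemma pmem_intro {G f x y} {Q : V -> V -> prop} :
  (G ⊩ spec f (fun u => ∃ a b, isPair u a b ∧ Q a b)%k) -> (G ⊩ Q x y) -> G ⊩ pmem x y f.
Proof.
  intros H K. assert (E := pair_ex (G := G) x y). kex E as p E. apply (exI p). split; auto.
  apply (specE H), (exI x), (exI y). now split.
Qed.

(** * Church numbers *)

Notation idP u := (∃ x, x = x ∧ isPair u x x)%k.
Notation church0P u := (∃ f, f = f ∧ pairP u (fun t => t = f) (fun t => spec t (fun u => idP u)))%k.
(** Membership in the composite of $z f$ followed by $f$, with [t] the value $z f$. *)
Definition compP (f z u : V) : prop :=
  ∃ x w t q, isPair u x w ∧ func t ∧ pmem f t z ∧ pmem x q t ∧ pmem q w f.
Definition succP (z v : V) : prop := ∃ f p, isPair v f p ∧ func f ∧ spec p (compP f z).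
Definition churchSP (v : V) : prop :=
  ∃ z, func z ∧ pairP v (fun t => t = z)%k (fun t => spec t (succP z)).
#[local] Hint Unfold compP succP churchSP : strat.

Definition church_n (n : V) : prop :=
  ∀ w, (∃ z, spec z (fun u => church0P u) ∧ z ∈ w) ∧
       (∀ x, x ∈ w ⇒ ∃ s, spec s (fun t => ∃ y, (∃ p, isPair p x y ∧ churchSP p) ∧ t ∈ y) ∧ s ∈ w) ⇒
       n ∈ w.
Definition church_conclusion : prop :=
  ∀ j, church_n j ⇒
    ∀ t, (∃ y, (∃ p, pairP p (fun t => spec t (fun u => church0P u)) (fun t => t = y) ∧
               ∃ f, (∃ r, pairP r (fun t => spec t churchSP) (fun t => t = f) ∧ r ∈ j) ∧ p ∈ f)
             ∧ t ∈ y) ⇔ t ∈ j.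

Lemma church_force e G : (G ⊩ force e (church_counting 0)) = (G ⊩ church_conclusion).
Proof. cbv -[at_ kMem kEq kAnd kOr kImp kAll kEx kBot]; reflexivity. Qed.

Notation isS S := (spec S churchSP).
Notation isC0 z := (spec z (fun u => church0P u)).
Notation isCS s z := (spec s (succP z)).

Lemma S_intro {G S z s} : (G ⊩ isS S) -> (G ⊩ func z) -> (G ⊩ isCS s z) -> G ⊩ pmem z s S.
Proof.
  intros HS Hz Hs. assert (E := pair_ex (G := G) z s). kex E as p E.
  apply (exI p). split; auto. apply (specE HS), (exI z). split; auto.
  exact (pairP_cong (kiff_refl _) (name_spec Hs) E).
Qed.

Lemma S_elim {G S z s} : (G ⊩ isS S) -> (G ⊩ pmem z s S) -> G ⊩ func z ∧ isCS s z.
Proof.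
  intros HS H. kex H as p [H1 H2]. apply (specE HS) in H2. kex H2 as z' [H2 H3].
  kset s' Hs (fun v => succP z' v).
  apply (pairP_cong (kiff_refl _) (spec_name Hs)) in H3.
  destruct (pair_inj H1 H3) as [E1 E2]. ksubst E1. ksubst E2. now split.
Qed.

Lemma S_func {G S} : (G ⊩ isS S) -> G ⊩ func S.
Proof.
  intros HS x y z; ki H1; ki H2.
  exact (spec_ext (proj2 (S_elim HS H1)) (proj2 (S_elim HS H2))).
Qed.

Lemma CS_intro {G z s f p} : (G ⊩ isCS s z) -> (G ⊩ func f) -> (G ⊩ spec p (compP f z)) ->
  G ⊩ pmem f p s.
Proof.
  intros Hs Hf Hp. exact (pmem_intro (Q := fun f p => func f ∧ spec p (compP f z))%k Hs (conj Hf Hp)).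
Qed.

Lemma CS_func {G z s} : (G ⊩ isCS s z) -> G ⊩ func s.
Proof.
  intros Hs f p q; ki H1; ki H2.
  apply (pmem_spec (Q := fun f p => func f ∧ spec p (compP f z))%k Hs) in H1, H2.
  kex H1 as f1 H1; kex H1 as p1 [E1 [E2 [_ H1]]].
  kex H2 as f2 H2; kex H2 as p2 [E3 [E4 [_ H2]]].
  ksubst E1. ksubst E2. ksubst E3. ksubst E4. exact (spec_ext H1 H2).
Qed.

Lemma comp_intro {G p f z t x q w} : (G ⊩ spec p (compP f z)) -> (G ⊩ func t) ->
  (G ⊩ pmem f t z) -> (G ⊩ pmem x q t) -> (G ⊩ pmem q w f) -> G ⊩ pmem x w p.
Proof.
  intros Hp Ht H1 H2 H3. assert (E := pair_ex (G := G) x w). kex E as u E.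
  apply (exI u). split; auto. apply (specE Hp), (exI x), (exI w), (exI t), (exI q).
  exact (conj E (conj Ht (conj H1 (conj H2 H3)))).
Qed.

Lemma comp_elim {G p f z x w} : (G ⊩ spec p (compP f z)) -> (G ⊩ pmem x w p) ->
  G ⊩ ∃ t q, func t ∧ pmem f t z ∧ pmem x q t ∧ pmem q w f.
Proof.
  intros Hp H. kex H as u [E H]. apply (specE Hp) in H.
  kex H as x' H; kex H as w' H; kex H as t H; kex H as q [E' H].
  destruct (pair_inj E E') as [E1 E2]. apply (exI t), (exI q). ksubst E1. ksubst E2. auto.
Qed.

Lemma comp_func {G p f z} : (G ⊩ spec p (compP f z)) -> (G ⊩ func f) -> (G ⊩ func z) ->
  G ⊩ func p.
Proof.
  intros Hp Hf Hz x w w'; ki H; ki H'.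
  apply (comp_elim Hp) in H, H'.
  kex H as t H; kex H as q [H1 [H2 [H3 H4]]]. kex H' as t' H'; kex H' as q' [_ [K2 [K3 K4]]].
  assert (E := Hz f t t' ∙ H2 ∙ K2). ksubst E.
  assert (E := H1 x q q' ∙ H3 ∙ K3). ksubst E. exact (Hf q' w w' ∙ H4 ∙ K4).
Qed.

Lemma id_mem {G i x} : (G ⊩ spec i (fun u => idP u)) -> G ⊩ pmem x x i.
Proof.
  intros Hi. assert (E := pair_ex (G := G) x x). kex E as u E.
  apply (exI u). split; auto. apply (specE Hi), (exI x). exact (conj (keq_refl x) E).
Qed.

Lemma id_func {G i} : (G ⊩ spec i (fun u => idP u)) -> G ⊩ func i.
Proof.
  intros Hi x y z; ki H1; ki H2. kex H1 as p [H1 K1]. kex H2 as q [H2 K2].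
  apply (specE Hi) in K1, K2. kex K1 as a [_ K1]. kex K2 as b [_ K2].
  destruct (pair_inj H1 K1) as [E1 E2]. destruct (pair_inj H2 K2) as [E3 E4].
  ksubst E1. ksubst E2. ksubst E4. exact E3.
Qed.

Lemma C0_mem {G Z i f} : (G ⊩ isC0 Z) -> (G ⊩ spec i (fun u => idP u)) -> G ⊩ pmem f i Z.
Proof.
  intros HZ Hi. assert (E := pair_ex (G := G) f i). kex E as u E.
  apply (exI u). split; auto. apply (specE HZ), (exI f). split; [apply keq_refl|].
  exact (pairP_cong (kiff_refl _) (name_spec Hi) E).
Qed.

Lemma C0_func {G Z} : (G ⊩ isC0 Z) -> G ⊩ func Z.
Proof.
  intros HZ. kset i Hi (fun u => idP u)%k. intros x y z; ki H1; ki H2.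
  assert (K : forall G y, (G ⊩ isC0 Z) -> (G ⊩ spec i (fun u => idP u)) -> (G ⊩ pmem x y Z) -> G ⊩ y = i).
  { clear; intros G y HZ Hi H. kex H as p [H1 H2]. apply (specE HZ) in H2. kex H2 as a [_ H2].
    apply (pairP_cong (kiff_refl _) (spec_name Hi)) in H2. apply (pair_inj H1 H2). }
  assert (E1 := K _ _ HZ Hi H1). assert (E2 := K _ _ HZ Hi H2). ksubst E1. now apply keq_sym.
Qed.

(** Functionality is built into the induction because $\mathsf{S}$ is defined on functions only: for
    functional [x] the class $Ap(\mathsf{S},x)$ is the set $s_x$. *)
Lemma N_ind (D : V -> prop) {G} : stratP (fun x => func x ∧ D x)%k ->
  (G ⊩ ∀ z, isC0 z ⇒ D z) ->
  (G ⊩ ∀ x s, func x ⇒ isCS s x ⇒ D x ⇒ D s) ->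
  G ⊩ ∀ j, church_n j ⇒ func j ∧ D j.
Proof.
  intros HD H0 H1 j; ki Hj.
  kset S HS churchSP.
  refine (exE _ (compr G _ HD) _); intros G' w s Hw; up s.
  assert (K : G ⊩ j ∈ w).
  { apply (impE (Hj w)). split.
    - kset z Hz (fun u => church0P u)%k. apply (exI z). split; auto.
      apply (specE Hw). split; [exact (C0_func Hz)|exact (H0 ⋅ Hz)].
    - intros x; ki Hx. apply (specE Hw) in Hx. destruct Hx as [Hx HDx].
      kset s Hs (fun v => succP x v). apply (exI s). split.
      + intros t; split; ki Ht.
        * apply (exI s). split; auto.
          assert (K := S_intro HS Hx Hs). kex K as p [K1 K2]. apply (exI p).
          split; auto. now apply (specE HS).
        * kex Ht as y [Ht Hty]. kex Ht as p [Ht Hp].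
          assert (K : G ⊩ pmem x y S) by (apply (exI p); split; auto; now apply (specE HS)).
          assert (E := spec_ext (proj2 (S_elim HS K)) Hs). now ksubst E.
      + apply (specE Hw). split; [exact (CS_func Hs)|exact (H1 x s ∙ Hx ∙ Hs ∙ HDx)]. }
  now apply (specE Hw) in K.
Qed.

(** * The correspondence between Frege and Church numbers *)

(** The least relation that links zero to [Z] and is closed under taking both successors at once, as
    an intersection of sets of pairs; thus [x] and [j] have the same type. *)
Definition numR (Z S x j : V) : prop :=
  ∀ w, (∀ z, isZero z ⇒ pmem z Z w) ⇒
       (∀ x y j s, inF x ⇒ isSucc y x ⇒ pmem j s S ⇒ pmem x j w ⇒ pmem y s w) ⇒
       pmem x j w.

#[local] Hint Unfold numR : strat.

Lemma numR_zero {G Z S z} : (G ⊩ isZero z) -> G ⊩ numR Z S z Z.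
Proof. intros Hz w; ki H0; ki H1. exact (H0 ⋅ Hz). Qed.

Lemma numR_succ {G Z S x y j s} : (G ⊩ inF x) -> (G ⊩ isSucc y x) -> (G ⊩ pmem j s S) ->
  (G ⊩ numR Z S x j) -> G ⊩ numR Z S y s.
Proof.
  intros Hx Hy Hs H w; ki H0; ki H1. exact (H1 x y j s ∙ Hx ∙ Hy ∙ Hs ∙ (H w ∙ H0 ∙ H1)).
Qed.

(** By minimality it suffices that the pairs of either form make a closed set. Membership in [numR]
    is kept in [Q] so that the predecessors are related too. *)
Lemma numR_inv {G Z S x j} : (G ⊩ numR Z S x j) ->
  G ⊩ (isZero x ∧ j = Z) ∨ ∃ x0 j0, inF x0 ∧ isSucc x x0 ∧ pmem j0 j S ∧ numR Z S x0 j0.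
Proof.
  intros H.
  set (Q := fun x j => (numR Z S x j ∧
    ((isZero x ∧ j = Z) ∨ ∃ x0 j0, inF x0 ∧ isSucc x x0 ∧ pmem j0 j S ∧ numR Z S x0 j0))%k).
  assert (E : G ⊩ ∃ w, spec w (fun u => ∃ x j, isPair u x j ∧ Q x j)) by (apply compr; subst Q; strat).
  kex E as w Hw.
  assert (K : G ⊩ pmem x j w).
  { apply (fun A B => H w ∙ A ∙ B).
    - intros z; ki Hz. apply (pmem_intro Hw). split; [exact (numR_zero Hz)|].
      apply orI1. exact (conj Hz (keq_refl Z)).
    - intros a b k s; ki Ha; ki Hb; ki Hk; ki L. apply (pmem_spec Hw) in L.
      kex L as a' L; kex L as k' [E1 [E2 [L _]]]. ksubst E1. ksubst E2.
      apply (pmem_intro Hw). split; [exact (numR_succ Ha Hb Hk L)|].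
      apply orI2, (exI a'), (exI k'). exact (conj Ha (conj Hb (conj Hk L))). }
  apply (pmem_spec Hw) in K. kex K as a K; kex K as k [E1 [E2 [_ K]]].
  ksubst E1. ksubst E2. exact K.
Qed.

Lemma zero_not_succ {G x y} (R : prop) : (G ⊩ isZero y) -> (G ⊩ isSucc y x) -> G ⊩ R.
Proof.
  intros Hz Hs. kset e He (fun _ => kBot).
  assert (K : G ⊩ e ∈ y) by now apply (specE Hz).
  apply (specE Hs) in K. exact (empty_succ _ He K).
Qed.

(** The induction is on the Frege side, where an inhabited successor determines its predecessor by
    [succ_inj]. *)
Lemma numR_fun {G Z S} : (G ⊩ isS S) ->
  G ⊩ ∀ x, inF x ⇒ ∀ j j', numR Z S x j ⇒ numR Z S x j' ⇒ j = j'.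
Proof.
  intros HS. apply F_ind; [strat|..].
  - intros z; ki Hz; intros j j'; ki H; ki H'.
    kor (numR_inv H) as [_ K]|K; [|kex K as a K; kex K as k [_ [K _]]; exact (zero_not_succ _ Hz K)].
    kor (numR_inv H') as [_ K']|K';
      [|kex K' as a K'; kex K' as k [_ [K' _]]; exact (zero_not_succ _ Hz K')].
    ksubst K. now apply keq_sym.
  - intros x y; ki Hx; ki Hy; ki Hi; ki IH; intros j j'; ki H; ki H'.
    kor (numR_inv H) as [K _]|K; [exact (zero_not_succ _ K Hy)|].
    kor (numR_inv H') as [K' _]|K'; [exact (zero_not_succ _ K' Hy)|].
    kex K as a K; kex K as k [A1 [A2 [A3 A4]]].
    kex K' as b K'; kex K' as l [B1 [B2 [B3 B4]]].
    kex Hi as v Hi.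
    assert (E := succ_inj A1 Hx A2 Hy Hi). assert (E' := succ_inj B1 Hx B2 Hy Hi).
    ksubst E. ksubst E'. assert (E := IH k l ∙ A4 ∙ B4). ksubst E.
    exact (S_func HS l j j' ∙ A3 ∙ B3).
Qed.

(** [t] stands for $j\,\mathsf{S}$ and [q] for $j\,\mathsf{S}\,\mathbf{0}$. Each application lowers
    the type by three and each [theta] by two, so three [theta] links bring [y3] to the type of [q].
    The parameters [Z] and [S] occur at several types. *)
Definition linked (Z S j : V) : prop :=
  ∃ x y1 y2 y3 t q, (inF x ∧ inF y1 ∧ inF y2 ∧ inF y3) ∧
    (theta x y1 ∧ theta y1 y2 ∧ theta y2 y3) ∧ numR Z S x j ∧ numR Z S y3 q ∧
    func t ∧ func q ∧ pmem S t j ∧ pmem Z q t.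

#[local] Hint Unfold linked : strat.

Lemma linked_church {G Z S} : (G ⊩ rosser) -> (G ⊩ isC0 Z) -> (G ⊩ isS S) ->
  G ⊩ ∀ j, church_n j ⇒ func j ∧ linked Z S j.
Proof.
  intros HR HZ HS. apply N_ind; [strat|..].
  - intros c; ki Hc. assert (E := spec_ext Hc HZ).
    assert (K : G ⊩ linked Z S Z).
    { kset z Hz (fun e => isEmpty e). kset i Hi (fun u => idP u)%k.
      assert (Hz' := F_zero Hz). assert (Ht := HR ⋅ Hz').
      (* For $j = \mathbf{0}$ all four cardinals are zero, $\mathbf{0}\,\mathsf{S}$ is the identity
         [i], and the identity sends [Z] to itself. *)
      apply (exI z), (exI z), (exI z), (exI z), (exI i), (exI Z).
      split; [exact (conj Hz' (conj Hz' (conj Hz' Hz')))|].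
      split; [exact (conj Ht (conj Ht Ht))|].
      split; [exact (numR_zero Hz)|]. split; [exact (numR_zero Hz)|].
      split; [exact (id_func Hi)|]. split; [exact (C0_func HZ)|].
      split; [exact (C0_mem HZ Hi)|exact (id_mem Hi)]. }
    exact (leib (linked Z S) Z c ltac:(strat) (keq_sym _ _ E) K).
  - intros j s; ki Hj; ki Hs; ki H.
    kex H as x H; kex H as y1 H; kex H as y2 H; kex H as y3 H; kex H as t H;
      kex H as q [[F0 [F1 [F2 F3]]] [[T1 [T2 T3]] [R1 [R2 [Ht [Hq [M1 M2]]]]]]].
    kset x' X0 (fun v => succMem v x). kset y1' X1 (fun v => succMem v y1).
    kset y2' X2 (fun v => succMem v y2). kset y3' X3 (fun v => succMem v y3).
    assert (K := @rosser_succ G HR).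
    assert (I0 := K ⋅ F0 ⋅ X0). assert (I1 := K ⋅ F1 ⋅ X1).
    assert (I2 := K ⋅ F2 ⋅ X2). assert (I3 := K ⋅ F3 ⋅ X3).
    (* The successor of [j] sends $\mathsf{S}$ to [p], the composite of $j\,\mathsf{S}$ followed by
       $\mathsf{S}$. Hence [p] sends $\mathbf{0}$ to the successor [q'] of [q]. *)
    kset p Hp (compP S j). kset q' Hq' (succP q).
    apply (exI x'), (exI y1'), (exI y2'), (exI y3'), (exI p), (exI q').
    split; [exact (conj (F_succ F0 X0 I0) (conj (F_succ F1 X1 I1)
      (conj (F_succ F2 X2 I2) (F_succ F3 X3 I3))))|].
    split; [exact (conj (theta_succ F1 X1 I1 X0 T1) (conj (theta_succ F2 X2 I2 X1 T2)
      (theta_succ F3 X3 I3 X2 T3)))|].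
    assert (Q := S_intro HS Hq Hq').
    split; [exact (numR_succ F0 X0 (S_intro HS Hj Hs) R1)|].
    split; [exact (numR_succ F3 X3 Q R2)|].
    split; [exact (comp_func Hp (S_func HS) Hj)|]. split; [exact (CS_func Hq')|].
    split; [exact (CS_intro Hs (S_func HS) Hp)|exact (comp_intro Hp Ht M1 M2 Q)].
Qed.

Lemma church_of_rosser {G} : (G ⊩ rosser) -> G ⊩ church_conclusion.
Proof.
  intros HR j; ki Hj. kset Z HZ (fun u => church0P u)%k. kset S HS churchSP.
  destruct (linked_church HR HZ HS ⋅ Hj) as [Fj H].
  kex H as x H; kex H as y1 H; kex H as y2 H; kex H as y3 H; kex H as t H;
    kex H as q [[F0 [F1 [F2 F3]]] [[T1 [T2 T3]] [R1 [R2 [Ht [_ [M1 M2]]]]]]].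
  (* Rosser's axiom at [y1], [y2] and [y3] says that each is [theta]-related to itself, so every
     link of the chain is an equality. *)
  assert (E1 := theta_fun F0 F1 T1 (HR ⋅ F1)).
  assert (E2 := theta_fun F1 F2 T2 (HR ⋅ F2)).
  assert (E3 := theta_fun F2 F3 T3 (HR ⋅ F3)).
  assert (E : G ⊩ j = q).
  { clear T1 T2 T3. ksubst E1. ksubst E2. ksubst E3.
    exact ((numR_fun HS ⋅ F3) j q ∙ R1 ∙ R2). }
  (* It remains to see that the class $Ap(Ap(j,\mathsf{S}),\mathbf{0})$ has the elements of [q]: [j]
     and [t] are functional, so [t] and [q] are the only values. *)
  intros e; split.
  - ki K. kex K as y [K Ke]. kex K as p [K1 K]. kex K as f [K K2]. kex K as r [K3 K4].
    apply (pairP_cong (spec_name HZ) (kiff_refl _)) in K1.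
    apply (pairP_cong (spec_name HS) (kiff_refl _)) in K3.
    assert (L : G ⊩ pmem S f j) by (apply (exI r); now split).
    assert (L' : G ⊩ pmem Z y f) by (apply (exI p); now split).
    assert (Ef := Fj S f t ∙ L ∙ M1). ksubst Ef.
    assert (Ey := Ht Z y q ∙ L' ∙ M2). ksubst Ey.
    exact (leib (fun z => e ∈ z)%k q j ltac:(strat) (keq_sym _ _ E) Ke).
  - ki K. apply (exI q). split;
      [|exact (leib (fun z => e ∈ z)%k j q ltac:(strat) E K)].
    kex M2 as p [P1 P2]. kex M1 as r [P3 P4].
    apply (exI p). split; [exact (pairP_cong (name_spec HZ) (kiff_refl _) P1)|].
    apply (exI t). split; auto. apply (exI r).
    split; [exact (pairP_cong (name_spec HS) (kiff_refl _) P3)|auto].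
Qed.

Theorem theorem21p17 : INF_proves (fmImp rosser_counting church_counting).
Proof.
  (* Derivability of the closed implication is forcing under the identity environment. *)
  unfold INF_proves. rewrite <- (ren_id (fun n => n)) by auto. apply force_iff.
  change (nil ⊩ force (fun n => n) (rosser_counting 0) ⇒ force (fun n => n) (church_counting 0)).
  intros G _ H. rewrite church_force. rewrite rosser_force in H. now apply church_of_rosser.
Qed.
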